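(* Let $N\ge 2$, $1\le k<N$, and let $\Omega\subset\mathbb{R}^N$ be a bounded domain. Let $H:\Omega\times\mathbb{R}^N\to\mathbb{R}$ be continuous and such that $$H(x,t\xi)=tH(x,\xi)\qquad\forall (x,t,\xi)\in\Omega\times\mathbb{R}_+\times\mathbb{R}^N,$$ and such that there is a modulus of continuity $\omega$ with $$|H(x,\xi)-H(y,\xi)|\le\omega\big(|x-y|(1+|\xi|)\big)\qquad\forall x,y\in\Omega,\ \xi\in\mathbb{R}^N.$$ Let $b=\sup_{(x,\xi)\in\Omega\times B_1}|H(x,\xi)|$. Then $\overline{\mu}_k^-$ is finite and, if $\Omega\in\mathcal{C}_R$ and $bR<k$ for some $R>0$, there exists a nonpositive supersolution $v\not\equiv 0$ of $$\mathcal{P}^-_k(D^2v)+H(x,\nabla v)+\overline{\mu}_k^-v=0\ \text{ in }\Omega,\qquad v=0\ \text{ on }\partial\Omega,$$ that is, a lower semicontinuous function $v\le 0$ on $\overline\Omega$, $v\not\equiv 0$, with $v=0$ on $\partial\Omega$ and $\mathcal{P}^-_k(D^2v)+H(x,\nabla v)+\overline{\mu}_k^-v\le 0$ in $\Omega$ in the viscosity sense.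
   Context: For a real symmetric $N\times N$ matrix $X$ with ordered eigenvalues $\lambda_1(X)\le\cdots\le\lambda_N(X)$, $\mathcal{P}^-_k(X)=\sum_{i=1}^k\lambda_i(X)$. $B_R(y)$ is the open ball of radius $R$ centred at $y$, $B_1=B_1(0)$; $\mathcal{C}_R$ is the class of bounded domains $\Omega\subset\mathbb{R}^N$ such that $\Omega=\bigcap_{y\in Y}B_R(y)$ for some $Y\subset\mathbb{R}^N$. A modulus of continuity is a nondecreasing function $\omega:[0,\infty)\to[0,\infty)$ with $\omega(s)\to 0=\omega(0)$ as $s\to 0^+$. Viscosity sense: a real-valued $u$ is a subsolution, $F(x,u,\nabla u,D^2u)\ge 0$ (resp. supersolution, $F(x,u,\nabla u,D^2u)\le 0$) in $\Omega$ if it is upper (resp. lower) semicontinuous and, for every $x\in\Omega$ and every $C^2$ function $\varphi$ touching $u$ from above (resp. below) at $x$, $F(x,u(x),\nabla\varphi(x),D^2\varphi(x))\ge 0$ (resp. $\le 0$). $\overline{\mu}_k^-=\sup\{\mu\in\mathbb{R}:\ \exists\, w<0\text{ in }\overline\Omega,\ w\text{ a subsolution of }\mathcal{P}^-_k(D^2w)+H(x,\nabla w)+\mu w=0\text{ in }\Omega\}$, where $w$ is real-valued and upper semicontinuous on $\overline\Omega$. *)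

(* Defs.v *)
From HB Require Import structures.
From mathcomp Require Import all_boot all_order all_algebra.
From mathcomp Require Import polyrcf.
From mathcomp Require Import all_classical all_reals all_analysis.

Set Implicit Arguments.
Unset Strict Implicit.
Unset Printing Implicit Defensive.

Import Order.TTheory GRing.Theory Num.Theory.
Import numFieldNormedType.Exports.

Local Open Scope classical_set_scope.
Local Open Scope ring_scope.

Section euclidean.
Context {R : realType} {N : nat}.
Implicit Types (x y : 'rV[R]_N) (r : R) (Omega : set 'rV[R]_N).

(* The library norm and [ball] on ['rV[R]_N] are those of the sup norm (same
   topology and bounded sets); Euclidean lengths and balls are defined here. *)
Definition enorm x : R := Num.sqrt (\sum_(i < N) x 0 i ^+ 2).

Definition eball y r : set 'rV[R]_N := [set x | enorm (x - y) < r].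

Definition bounded_domain Omega : Prop :=
  [/\ open Omega, connected Omega, Omega !=set0 & bounded_set Omega].

Definition ball_intersection_class r : set (set 'rV[R]_N) :=
  [set Omega | bounded_domain Omega /\
     exists Y : set 'rV[R]_N, Omega = \bigcap_(y in Y) eball y r].

Definition boundary Omega : set 'rV[R]_N := closure Omega `\` interior Omega.

End euclidean.

Section truncated_laplacian.
Context {R : realType} {N : nat}.
Implicit Type X : 'M[R]_N.

(* The real eigenvalues of [X] in nondecreasing order, each repeated according
   to its multiplicity; [rootsR] lists the distinct real roots in increasing
   order. For symmetric [X] this is lambda_1(X) <= ... <= lambda_N(X). *)
Definition eigenvalues X : seq R :=
  flatten [seq nseq (mup a (char_poly X)) a | a <- rootsR (char_poly X)].

(* Indices start at 0: lambda_(i+1)(X) is [(eigenvalues X)`_i]. *)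
Definition Pminus (k : nat) X : R := \sum_(i < k) (eigenvalues X)`_i.

End truncated_laplacian.

Section viscosity.
Context {R : realType} {N : nat}.
Implicit Types (x : 'rV[R]_N) (u phi : 'rV[R]_N -> R) (A : set 'rV[R]_N).

Definition partial (i : 'I_N) phi : 'rV[R]_N -> R :=
  fun x => 'D_(delta_mx 0 i) phi x.

Definition gradient phi x : 'rV[R]_N := \row_i partial i phi x.

Definition hessian phi x : 'M[R]_N :=
  \matrix_(i, j) partial i (partial j phi) x.

(* phi is of class C^2 in a neighbourhood of x. *)
Definition C2_near phi x : Prop :=
  \forall y \near x,
    (forall i : 'I_N, derivable phi y (delta_mx 0 i) /\
                      {for y, continuous (partial i phi)}) /\
    (forall i j : 'I_N, derivable (partial j phi) y (delta_mx 0 i) /\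
                        {for y, continuous (partial i (partial j phi))}).

(* Semicontinuity on A is relative to A, hence the subspace topology. *)
Definition lsc_on A u : Prop :=
  lower_semicontinuous (fun x : subspace A => (u x)%:E).

Definition usc_on A u : Prop := lsc_on A (fun x => - u x).

Definition touches_above phi u x : Prop :=
  phi x = u x /\ \forall y \near x, u y <= phi y.

Definition touches_below phi u x : Prop :=
  phi x = u x /\ \forall y \near x, phi y <= u y.

Definition operator := 'rV[R]_N -> R -> 'rV[R]_N -> 'M[R]_N -> R.

(* In both definitions A is meant to be open, so that a neighbourhood of a
   point of A may be taken inside A. *)
Definition viscosity_subsolution (F : operator) A u : Prop :=
  usc_on A u /\
  forall x phi, A x -> C2_near phi x -> touches_above phi u x ->
    0 <= F x (u x) (gradient phi x) (hessian phi x).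

Definition viscosity_supersolution (F : operator) A u : Prop :=
  lsc_on A u /\
  forall x phi, A x -> C2_near phi x -> touches_below phi u x ->
    F x (u x) (gradient phi x) (hessian phi x) <= 0.

End viscosity.

Section eigenvalue_problem.
Context {R : realType} {N : nat}.
Variables (k : nat) (Omega : set 'rV[R]_N) (H : 'rV[R]_N -> 'rV[R]_N -> R).

Definition eigen_operator (mu : R) : operator :=
  fun x r xi X => Pminus k X + H x xi + mu * r.

Definition mubar_minus : \bar R :=
  ereal_sup [set mu%:E | mu in [set mu : R |
    exists w : 'rV[R]_N -> R,
      [/\ usc_on (closure Omega) w,
          forall x, closure Omega x -> w x < 0 &
          viscosity_subsolution (eigen_operator mu) Omega w]]].

Definition positively_homogeneous : Prop :=
  forall x (t : R) xi, Omega x -> 0 <= t -> H x (t *: xi) = t * H x xi.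

Definition modulus_of_continuity (omega : R -> R) : Prop :=
  [/\ forall s, 0 <= s -> 0 <= omega s,
      forall s t, 0 <= s -> s <= t -> omega s <= omega t,
      omega 0 = 0 &
      omega s @[s --> 0^'+] --> 0].

Definition structure_condition (omega : R -> R) : Prop :=
  forall x y xi, Omega x -> Omega y ->
    `|H x xi - H y xi| <= omega (enorm (x - y) * (1 + enorm xi)).

(* For Omega bounded and nonempty and H continuous, the structure condition
   makes this set bounded, so that the real [sup] is the actual supremum. *)
Definition unit_ball_sup : R :=
  sup [set `|H z.1 z.2| | z in Omega `*` eball 0 1].

End eigenvalue_problem.

(* Main.v *)
Require Import Defs.
From HB Require Import structures.
From mathcomp Require Import all_boot all_order all_algebra.
From mathcomp Require Import all_classical all_reals all_analysis.
From mathcomp Require Import polyrcf complex perm.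
From mathcomp Require Import ring lra.

(** Write [F phi x] for [Pminus k (D^2 phi x) + H x (grad phi x)].

    The eigenvalue is finite. The constant [-1] is an admissible subsolution for
    [mu = 0], because [H x 0 = 0]. Conversely, let [w < 0] be a subsolution for
    [mu], and let [g = |x - a|^2 - r^2] on a ball of [Omega]. Since [g ^ 2 / - w],
    extended by 0 outside the ball, attains its maximum, some negative multiple
    [- C g ^ 2] touches [w] from above at a point of the ball
    ([admissible_bounded]). There the subsolution inequality reads, with
    [t = - g > 0], [mu t ^ 2 <= A t - B] for constants [A] and [B > 0], which forces
    [mu <= A ^ 2 / B]: the term [- B] comes from the rank-one part of the Hessian of
    [- g ^ 2], which lowers the sum of the [k] smallest eigenvalues even where [g]
    vanishes.

    For the supersolution, let [supersol_class mu c] be the set of lower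
    semicontinuous functions with values in [[-1, 0]] that vanish on the boundary
    and satisfy [F v + mu v <= c] in the viscosity sense. A single object does all
    the work: [perron mu c], the lower relaxed limit, as [e -> 0], of all members
    of [supersol_class (mu + e) (c + e)]. It lies below every member of
    [supersol_class mu c], and it is itself a member ([perron_in_class]): the
    viscosity inequality is the usual stability under relaxed limits
    ([perron_supersolution]), and the boundary values come from the paraboloids
    [|x - y|^2 - rho^2] with [y] a centre of one of the balls whose intersection is
    [Omega]. They are strict subsolutions because [b rho < k], so that each member
    of the class stays above a fixed multiple of each paraboloid ([barrier]); and at
    a given boundary point some paraboloid is as close to 0 as desired
    ([sqdist_near_radius]).

    The limit is not trivial. Suppose that [mu] exceeds the eigenvalue, [c > 0] and
    [perron mu c > - 1 / 2]. Then the constraint [v >= -1] is not active and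
    [perron mu c] can be lowered wherever its upper semicontinuous envelope [W]
    fails to be a subsolution ([usc_envelope_subsolution]). By minimality
    it cannot, so that [W - c / (mu + 1)] is a negative subsolution for [mu], and
    [mu] does not exceed the eigenvalue. Hence [perron mu c] takes a value
    [<= - 1 / 2] ([perron_nontrivial]); by compactness this passes to the limit
    [perron mubar 0] ([perron_limit_nontrivial]), which is the required function.

    It remains to handle the operator and the test functions. Degenerate ellipticity and
    continuity of [Pminus] on symmetric matrices follow from the Ky Fan principle:
    [Pminus k X] is the minimum, over orthonormal bases, of the sum of [k] diagonal
    entries of [X] ([Pminus_le_rayleigh], [Pminus_rayleigh_attained]). Test functions
    are given by continuous partial derivatives only, so the symmetry of the Hessian
    and the second-order condition at a maximum are derived from the mean value
    theorem ([hessian_symmetric], [local_max_derivatives]). *)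

Set Implicit Arguments.
Unset Strict Implicit.
Unset Printing Implicit Defensive.

Import Order.TTheory GRing.Theory Num.Theory.
Import numFieldNormedType.Exports.

Local Open Scope classical_set_scope.
Local Open Scope ring_scope.

(** * Sums of the smallest eigenvalues *)

Lemma char_poly_conj (F : fieldType) n (P A : 'M[F]_n) : P \in unitmx ->
  char_poly (invmx P *m A *m P) = char_poly A.
Proof.
move=> uP; pose p := map_mx (@polyC F) P.
pose p' := map_mx (@polyC F) (invmx P).
have p'p : p' *m p = 1%:M by rewrite -map_mxM mulVmx // map_mx1.
have -> : char_poly (invmx P *m A *m P) = \det (p' *m char_poly_mx A *m p).
  rewrite /char_poly; congr (\det _).
  rewrite /char_poly_mx mulmxBr mulmxBl -!map_mxM; congr (_ - _).
  by rewrite scalar_mxC -mulmxA p'p mulmx1.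
by rewrite !det_mulmx mulrAC -det_mulmx p'p det1 mul1r.
Qed.

(** This and the two lemmas on [flatten] identify the list of roots with multiplicity
    of a split polynomial with the sorted list of its linear factors. *)
Lemma mup_prod_XsubC (F : fieldType) (s : seq F) a :
  mup a (\prod_(x <- s) ('X - x%:P)) = count_mem a s.
Proof.
elim: s => [|x s IH]; first by rewrite big_nil mupNroot // root1.
rewrite big_cons mupM ?polyXsubC_eq0 ?monic_neq0 ?monic_prod_XsubC// IH /=.
by have := mup_XsubCX 1 a x; rewrite expr1 => ->; rewrite eq_sym; case: eqP.
Qed.

Lemma sorted_flatten_nseq (disp : Order.disp_t) (T : orderType disp) (m : T -> nat) (s : seq T) :
  sorted <=%O s -> sorted <=%O (flatten [seq nseq (m a) a | a <- s]).
Proof.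
rewrite !sorted_pairwise; try exact: le_trans.
elim: s => //= x s IH /andP[xs /IH ps]; rewrite pairwise_cat ps andbT.
apply/andP; split.
  apply/allrelP => u v /nseqP[-> _] /flattenP[t /mapP[y ys ->] /nseqP[-> _]].
  exact: (allP xs).
by elim: (m x) => //= k ->; rewrite andbT; apply/allP => y /nseqP[->].
Qed.

Lemma count_flatten_nseq (T : eqType) (m : T -> nat) (s : seq T) a :
  count_mem a (flatten [seq nseq (m x) x | x <- s]) = (count_mem a s * m a)%N.
Proof.
elim: s => //= x s IH; rewrite count_cat IH count_nseq mulnDl /=.
by case: (x =P a) => [->|]; rewrite ?mul0n.
Qed.

Section spectrum.
Import Num.Def.
Local Open Scope sesquilinear_scope.
Context {R : realType} {N : nat}.
Implicit Types X Y : 'M[R]_N.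

Lemma eigenvalues_of_split X (s : seq R) :
  char_poly X = \prod_(x <- s) ('X - x%:P) -> eigenvalues X = sort <=%R s.
Proof.
move=> Xs; have pn0 : char_poly X != 0 by rewrite monic_neq0 // char_poly_monic.
have sr : sorted <%R (rootsR (char_poly X)) by exact: sorted_roots.
apply: (@sorted_eq _ <=%R).
- exact: le_trans.
- exact: le_anti.
- apply: sorted_flatten_nseq; by have := lt_sorted_is_uniq_le sr => /andP[].
- by apply: sort_sorted; exact: le_total.
- apply/allP => a _ /=; apply/eqP.
rewrite (seq.permP (permEl (perm_sort _ s)) _) count_flatten_nseq.
rewrite -(mup_prod_XsubC s) -Xs.
have := roots_on_rootsR pn0 a; rewrite in_itv /= => ra.
have [Xa|Xa] := boolP (root (char_poly X) a); last by rewrite mupNroot ?muln0.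
by rewrite count_uniq_mem ?(proj1 (andP (lt_sorted_is_uniq_le sr))) // -ra Xa mul1n.
Qed.

Local Notation C := R[i].
Local Notation toC := (map_mx (real_complex R)).

Definition sqmod (z : C) : R := complex.Re (z * conjC z).

Lemma sqmodE z : (sqmod z)%:C%C = z * conjC z.
Proof. by rewrite RRe_real // ger0_real // mul_conjC_ge0. Qed.

Lemma sqmod_ge0 z : 0 <= sqmod z.
Proof. by rewrite -lecR sqmodE mul_conjC_ge0. Qed.

(** The [i]-th diagonal entry of [X] in the orthonormal basis given by the rows of
    [Q]. Complex bases are used because the diagonalization of Hermitian matrices
    takes place over the algebraically closed field [R[i]]; for symmetric [X] the
    entry is real. *)
Definition rayleigh X (Q : 'M[C]_N) (i : 'I_N) : R :=
  complex.Re ((Q *m toC X *m Q^t*) i i).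

Lemma sqmod_row_sum (Q : 'M[C]_N) i : Q \is unitarymx -> \sum_j sqmod (Q i j) = 1.
Proof.
move=> /unitarymxP /matrixP /(_ i i); rewrite !mxE eqxx => QQ.
apply: complexI; rewrite rmorph_sum /= -[RHS]QQ.
by apply: eq_bigr => j _; rewrite sqmodE !mxE.
Qed.

Lemma sqmod_col_sum (Q : 'M[C]_N) j : Q \is unitarymx -> \sum_i sqmod (Q i j) = 1.
Proof.
move=> uQ; have uQT : Q^T \is unitarymx by rewrite trmx_unitary.
by rewrite -(sqmod_row_sum j uQT); apply: eq_bigr => i _; rewrite mxE.
Qed.

Lemma symmetric_diagonalization X : X^T = X ->
  exists P : 'M[C]_N, exists2 d : 'I_N -> R, P \is unitarymx &
   toC X = P^t* *m diag_mx (\row_i (d i)%:C%C) *m P.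
Proof.
move=> sX; have hX : toC X \is hermsymmx.
  apply: realsym_hermsym; first by apply/is_hermitianmxP; rewrite expr0 scale1r map_mx_id // map_trmx sX.
  by apply/mxOverP => i j; rewrite !mxE complex_real.
have /orthomx_spectralP XE := hermitian_normalmx hX.
have Dr := hermitian_spectral_diag_real hX.
have := spectral_unitarymx (toC X); move: XE Dr.
move: (spectralmx _) (spectral_diag _) => P D XE Dr uP.
exists P, (fun i => complex.Re (D 0 i)); first exact: uP.
have -> : \row_i (complex.Re (D 0 i))%:C%C = D.
  by apply/rowP => i; rewrite !mxE RRe_real //; have /mxOverP := Dr; apply.
by rewrite -invmx_unitary.
Qed.

Lemma eigenvalues_diag X (P : 'M[C]_N) (d : 'I_N -> R) : P \is unitarymx ->
  toC X = P^t* *m diag_mx (\row_i (d i)%:C%C) *m P ->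
  eigenvalues X = sort <=%R (codom d).
Proof.
move=> uP XE; apply: eigenvalues_of_split.
apply: (@map_poly_inj _ _ (real_complex R)).
rewrite map_char_poly XE -invmx_unitary // char_poly_conj ?unitarymx_unit //.
rewrite char_poly_trig ?diag_mx_is_trig // rmorph_prod big_map big_enum /=.
by apply: eq_bigr => i _; rewrite !mxE eqxx mulr1n rmorphB /= map_polyX map_polyC.
Qed.

(** The rows of the diagonalizing matrix are permuted so that the eigenvalues come
    in the order in which [eigenvalues] lists them. *)
Lemma spectral_theorem X : X^T = X ->
  exists2 P : 'M[C]_N, P \is unitarymx &
   forall Q i, rayleigh X Q i =
     \sum_(j < N) (eigenvalues X)`_j * sqmod ((Q *m P^t*) i j).
Proof.
move=> /symmetric_diagonalization [P [d uP XE]].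
have eX := eigenvalues_diag uP XE.
have [s sE] : exists s : 'S_N, forall j : 'I_N, (eigenvalues X)`_j = d (s j).
  have sz : size (eigenvalues X) == N by rewrite eX size_sort size_codom card_ord.
  have szd : size (codom d) == N by rewrite size_codom card_ord.
  have /tuple_permP[s es] : perm_eq (Tuple sz) (Tuple szd).
    by rewrite /= eX perm_sort.
  exists s => j; have -> : eigenvalues X = Tuple sz by [].
  rewrite es (nth_map j) ?size_enum_ord // nth_ord_enum.
  by rewrite (tnth_nth 0) /= (nth_map j) ?size_enum_ord // nth_ord_enum.
have uP' : row_perm s P \is unitarymx.
  apply/unitarymxP/matrixP => i j; rewrite !mxE.
  have /unitarymxP/matrixP/(_ (s i) (s j)) := uP; rewrite !mxE (inj_eq perm_inj) => <-.
  by apply: eq_bigr => l _; rewrite !mxE.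
exists (row_perm s P) => // Q i.
apply: complexI; rewrite rmorph_sum /=.
have QE : Q *m toC X *m Q^t* =
    (Q *m P^t*) *m diag_mx (\row_i (d i)%:C%C) *m (Q *m P^t*)^t*.
  by rewrite XE trmx_mul map_mxM trmxCK !mulmxA.
have BE j : (Q *m (row_perm s P)^t*) i j = (Q *m P^t*) i (s j).
  by rewrite !mxE; apply: eq_bigr => l _; rewrite !mxE.
have RE : (Q *m toC X *m Q^t*) i i =
    \sum_(j < N) ((eigenvalues X)`_j * sqmod ((Q *m (row_perm s P)^t*) i j))%:C%C.
  rewrite QE mxE (reindex_inj (@perm_inj _ s)); apply: eq_bigr => j _.
  rewrite BE sE rmorphM /= sqmodE mul_mx_diag !mxE.
  by rewrite mulrAC mulrC.
by rewrite /rayleigh RE RRe_real // rpred_sum // => j _; rewrite complex_real.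
Qed.

Lemma eigenvalues_sorted X : X^T = X ->
  size (eigenvalues X) = N /\ sorted <=%R (eigenvalues X).
Proof.
move=> /symmetric_diagonalization[P [d uP XE]].
rewrite (eigenvalues_diag uP XE) size_sort size_codom card_ord; split=> //.
by apply: sort_sorted; exact: le_total.
Qed.

Lemma PminusE k X : (k <= N)%N ->
  Pminus k X = \sum_(i < N | (i < k)%N) (eigenvalues X)`_i.
Proof. by move=> kN; rewrite /Pminus (big_ord_widen _ (fun i => (eigenvalues X)`_i) kN). Qed.

Lemma sum_ord_lt (k : nat) : (k <= N)%N -> \sum_(i < N | (i < k)%N) (1 : R) = k%:R.
Proof.
by move=> kN; rewrite -(big_ord_widen _ (fun=> 1) kN) sumr_const card_ord.
Qed.

(** In an eigenbasis the right-hand side is a sum of the eigenvalues with weights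
    [w j] in [[0, 1]] of total mass [k], and such a sum is smallest when the mass
    sits on the [k] lowest eigenvalues. *)
Lemma Pminus_le_rayleigh k X (Q : 'M[C]_N) : (k <= N)%N -> X^T = X -> Q \is unitarymx ->
  Pminus k X <= \sum_(i < N | (i < k)%N) rayleigh X Q i.
Proof.
move=> kN sX uQ; have [P uP PE] := spectral_theorem sX.
have [sz srt] := eigenvalues_sorted sX.
have mono i j : (i <= j)%N -> (j < N)%N -> (eigenvalues X)`_i <= (eigenvalues X)`_j.
  move=> ij jN; apply: (sorted_leq_nth le_trans le_refl) => //;
  by rewrite inE sz // (leq_ltn_trans ij).
under eq_bigr do rewrite PE.
pose B := Q *m P^t*.
have uPt : P^t* \is unitarymx by rewrite trmxC_unitary.
have uB : B \is unitarymx := mul_unitarymx uQ uPt.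
rewrite -/B.
pose w j := \sum_(i < N | (i < k)%N) sqmod (B i j).
have w_ge0 j : 0 <= w j by apply: sumr_ge0 => i _; exact: sqmod_ge0.
have w_le1 j : w j <= 1.
  rewrite -(sqmod_col_sum j uB) /w big_mkcond; apply: ler_sum => i _.
  by case: ifP => // _; exact: sqmod_ge0.
have w_sum : \sum_j w j = k%:R.
  rewrite exchange_big /= -(sum_ord_lt kN).
  by apply: eq_bigr => i _; exact: sqmod_row_sum.
rewrite exchange_big /= PminusE //.
under [leRHS]eq_bigr => j _ do rewrite -mulr_sumr.
rewrite -subr_ge0 -/(w _).
(* Subtracting the threshold [m] changes nothing, as the weights and the indicator
   of [j < k] have the same sum; afterwards every term is nonnegative. *)
pose m := (eigenvalues X)`_k.-1.
have iE (F : 'I_N -> R) : \sum_(i < N | (i < k)%N) F i = \sum_(j < N) F j * (j < k)%N%:R.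
  by rewrite big_mkcond; apply: eq_bigr => j _; case: ifP; rewrite ?mulr1 ?mulr0.
have kE : \sum_(j < N) (j < k)%N%:R = k%:R :> R.
  by rewrite -(sum_ord_lt kN) iE; apply: eq_bigr => j _; rewrite mul1r.
rewrite iE.
have -> : \sum_(j < N) (eigenvalues X)`_j * w j -
      \sum_(j < N) (eigenvalues X)`_j * (j < k)%N%:R =
    \sum_(j < N) (eigenvalues X)`_j * w j - \sum_(j < N) (eigenvalues X)`_j * (j < k)%N%:R
    - m * (\sum_(j < N) w j - \sum_(j < N) (j < k)%N%:R).
  by rewrite w_sum kE subrr mulr0 subr0.
rewrite mulrBr !mulr_sumr -!sumrB; apply: sumr_ge0 => j _.
set c := (j < k)%N%:R.
have -> : (eigenvalues X)`_j * w j - (eigenvalues X)`_j * c - (m * w j - m * c) =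
   ((eigenvalues X)`_j - m) * (w j - c) by ring.
rewrite /c.
have [jk|kj] := ltnP j k.
  rewrite mulr_le0 // subr_le0 //.
  by apply: mono; rewrite -ltnS (ltn_predK jk) // (leq_trans jk).
by rewrite subr0 mulr_ge0 // subr_ge0 mono // (leq_trans (leq_pred _)).
Qed.

Lemma Pminus_rayleigh_attained k X : (k <= N)%N -> X^T = X ->
  exists2 Q : 'M[C]_N, Q \is unitarymx &
    Pminus k X = \sum_(i < N | (i < k)%N) rayleigh X Q i.
Proof.
move=> kN sX; have [P uP PE] := spectral_theorem sX.
exists P => //; rewrite PminusE //; apply: eq_bigr => i _.
have /unitarymxP PP := uP; rewrite PE (bigD1 i) //= big1 => [|j ji].
  by rewrite PP mxE eqxx /sqmod mul1r conjC1 /= mulr1 addr0.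
by rewrite PP mxE eq_sym (negPf ji) /sqmod mul0r /= mulr0.
Qed.

Definition qform X (v : 'I_N -> R) : R := \sum_i \sum_j v i * v j * X i j.

Lemma qformB X Y v : qform X v - qform Y v = qform (X - Y) v.
Proof.
rewrite /qform -sumrB; apply: eq_bigr => i _; rewrite -sumrB; apply: eq_bigr => j _.
by rewrite !mxE mulrBr.
Qed.

Lemma rayleighE X (Q : 'M[C]_N) i :
  rayleigh X Q i = qform X (fun j => complex.Re (Q i j)) + qform X (fun j => complex.Im (Q i j)).
Proof.
rewrite /rayleigh /qform mxE raddf_sum exchange_big /= [X in _ + X]exchange_big -big_split /=.
apply: eq_bigr => l _; rewrite !mxE mulr_suml raddf_sum /=.
rewrite -big_split /=; apply: eq_bigr => j _.
rewrite !mxE; case: (Q i j) (Q i l) => a b [c d] /=.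
ring.
Qed.

Lemma sqmod_ReIm z : sqmod z = complex.Re z ^+ 2 + complex.Im z ^+ 2 :> R.
Proof. by case: z => a b; rewrite /sqmod /= mulrN opprK !expr2. Qed.

Lemma ler_rayleigh X Y Q i : (forall v, qform X v <= qform Y v) ->
  rayleigh X Q i <= rayleigh Y Q i.
Proof. by move=> XY; rewrite !rayleighE lerD. Qed.

(** The minimum of a family of functions that are monotone in the matrix is
    monotone: compare both sides in the basis that is optimal for [Y]. *)
Lemma Pminus_mono k X Y : (k <= N)%N -> X^T = X -> Y^T = Y ->
  (forall v, qform X v <= qform Y v) -> Pminus k X <= Pminus k Y.
Proof.
move=> kN sX sY XY; have [Q uQ ->] := Pminus_rayleigh_attained kN sY.
apply: le_trans (Pminus_le_rayleigh kN sX uQ) _.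
by apply: ler_sum => i _; exact: ler_rayleigh.
Qed.

Lemma qform_bound X (e : R) v : (forall i j, `|X i j| <= e) ->
  qform X v <= e * N%:R * \sum_j v j ^+ 2.
Proof.
move=> Xe; have -> : e * N%:R * (\sum_j v j ^+ 2) =
   \sum_(i < N) \sum_(j < N) e / 2 * (v i ^+ 2 + v j ^+ 2).
  under [RHS]eq_bigr do rewrite -mulr_sumr big_split /= sumr_const card_ord.
  rewrite -mulr_sumr big_split /= sumr_const card_ord sumrMnl.
  by set S := \sum_(i < N) _; rewrite -[S *+ N]mulr_natr; field.
apply: ler_sum => i _; apply: ler_sum => j _.
apply: le_trans (ler_norm _) _; rewrite !normrM.
have h : `|v i| * `|v j| <= (v i ^+ 2 + v j ^+ 2) / 2.
  rewrite -[v i ^+ 2]real_normK ?num_real // -[v j ^+ 2]real_normK ?num_real //.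
  have := sqr_ge0 (`|v i| - `|v j|); nra.
apply: le_trans (ler_pM _ _ h (Xe i j)) _; rewrite ?mulr_ge0 //.
by lra.
Qed.

Lemma rayleigh_bound X Q i (e : R) : (forall i j, `|X i j| <= e) -> Q \is unitarymx ->
  rayleigh X Q i <= e * N%:R.
Proof.
move=> Xe uQ; rewrite rayleighE.
apply: (@le_trans _ _ (e * N%:R * \sum_j sqmod (Q i j))); last first.
  by rewrite sqmod_row_sum // mulr1.
under [X in _ <= _ * X]eq_bigr do rewrite sqmod_ReIm.
by rewrite big_split /= mulrDr; apply: lerD; exact: qform_bound.
Qed.

Lemma Pminus_lipschitz k X Y (e : R) : (k <= N)%N -> X^T = X -> Y^T = Y ->
  (forall i j, `|X i j - Y i j| <= e) -> Pminus k X <= Pminus k Y + e * N%:R * k%:R.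
Proof.
move=> kN sX sY XY; have [Q uQ ->] := Pminus_rayleigh_attained kN sY.
apply: le_trans (Pminus_le_rayleigh kN sX uQ) _.
rewrite -(sum_ord_lt kN) mulr_sumr -big_split /=; apply: ler_sum => i _.
have -> : rayleigh X Q i = rayleigh Y Q i + rayleigh (X - Y) Q i.
  by rewrite !rayleighE -!qformB; ring.
by rewrite lerD2l mulr1 rayleigh_bound // => a b; rewrite !mxE.
Qed.

Lemma Pminus_close k X Y (e : R) : (k <= N)%N -> X^T = X -> Y^T = Y ->
  (forall i j, `|X i j - Y i j| <= e) -> `|Pminus k X - Pminus k Y| <= e * N%:R * k%:R.
Proof.
move=> kN sX sY XY; rewrite ler_distl lerBlDr !Pminus_lipschitz // => i j.
by rewrite distrC.
Qed.

(** The coordinate basis, permuted so that a chosen entry is among the first [k]. *)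
Lemma Pminus_le_diag k X (s : 'S_N) : (k <= N)%N -> X^T = X ->
  Pminus k X <= \sum_(i < N | (i < k)%N) X (s i) (s i).
Proof.
move=> kN sX; have uQ : perm_mx s \is @unitarymx R[i] N N.
  by apply/unitarymxP; rewrite tr_perm_mx map_perm_mx -perm_mxM mulgV perm_mx1.
apply: le_trans (Pminus_le_rayleigh kN sX uQ) _; apply: ler_sum => i _.
have iE (F : 'I_N -> 'I_N -> R) (c : R) : (forall j l, F j l != 0 -> j = s i /\ l = s i) ->
    F (s i) (s i) = c -> \sum_j \sum_l F j l = c.
  move=> Fs <-; rewrite (bigD1 (s i)) //= [X in _ + X]big1 ?addr0 => [|j js]; last first.
    by apply: big1 => l _; apply: contra_neq_eq js => /Fs[].
  rewrite (bigD1 (s i)) //= big1 ?addr0 // => j js.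
  by apply: contra_neq_eq js => /Fs[].
rewrite rayleighE /qform (iE _ (X (s i) (s i))) ?(iE _ 0) ?addr0 //.
- by move=> j l; rewrite !mxE; case: (s i == j); rewrite /= !mul0r eqxx.
- by rewrite !mxE eqxx /= !mul0r.
- move=> j l; rewrite !mxE; case: (s i =P j) => [<-|_]; case: (s i =P l) => [<-|_] //=;
  by rewrite ?mulr0 !mul0r eqxx.
- by rewrite !mxE eqxx /= !mul1r.
Qed.

Lemma Pminus_scalar k (a : R) : (k <= N)%N -> Pminus k (a%:M : 'M[R]_N) = k%:R * a.
Proof.
move=> kN; have [Q uQ ->] := Pminus_rayleigh_attained kN (tr_scalar_mx N a).
rewrite -(sum_ord_lt kN) mulr_suml; apply: eq_bigr => i _.
rewrite rayleighE mul1r -[RHS]mulr1 -(sqmod_row_sum i uQ).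
under [in RHS]eq_bigr do rewrite sqmod_ReIm.
have qE v : qform a%:M v = a * \sum_j v j ^+ 2.
  rewrite mulr_sumr; apply: eq_bigr => j _; rewrite (bigD1 j) //= big1 => [|l lj].
    by rewrite mxE eqxx mulr1n addr0; ring.
  by rewrite mxE eq_sym (negPf lj) mulr0n mulr0.
by rewrite !qE big_split /= mulrDr.
Qed.
End spectrum.

(** * Test functions: first and second derivatives *)

Lemma near_norm {R : realType} {W : normedModType R} (x : W) (P : set W) :
  (\forall y \near (x : W), P y) <-> (exists2 r : R, 0 < r & forall y : W, `|y - x| < r -> P y).
Proof.
split=> [/nbhs_ballP[r r0 rP]|[r r0 rP]].
  by exists r => // y yr; apply: rP; rewrite -ball_normE /= distrC.
by apply/nbhs_ballP; exists r => // y; rewrite -ball_normE /= distrC; exact: rP.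
Qed.

Section calculus.
Context {R : realType} {N : nat}.
Notation V := 'rV[R]_N.
Notation "''e_' i" := (delta_mx 0 i : 'rV[R]_N) (at level 8, i at level 2).
Implicit Types (f : V -> R) (x y v : V).

Lemma is_derive_line f x v (t : R) d :
  is_derive (x + t *: v) v f d -> is_derive t (1 : R) (fun s : R => f (x + s *: v)) d.
Proof.
have E : (fun h : R => h^-1 *: (((fun s : R => f (x + s *: v)) \o shift t) (h *: 1) - f (x + t *: v)))
   = (fun h : R => h^-1 *: ((f \o shift (x + t *: v)) (h *: v) - f (x + t *: v))).
  apply/funext => h /=; congr (_ *: (f _ - _)).
  by rewrite [h *: 1]mulr1 scalerDl addrCA.
by case=> df dE; split; rewrite /derivable /derive E.
Qed.

Lemma MVT_line f x v (s : R) (df : R -> R) :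
  (forall t : R, `|t| <= `|s| -> is_derive (x + t *: v) v f (df t)) ->
  exists2 t, `|t| <= `|s| & f (x + s *: v) - f x = s * df t.
Proof.
move=> fd; pose g := fun u : R => f (x + u *: v).
have gd (t : R) : `|t| <= `|s| -> is_derive t (1 : R) g (df t) by move=> /fd/is_derive_line.
have g0 : g 0 = f x by rewrite /g scale0r addr0.
have gc (a b : R) : (forall t : R, a <= t <= b -> `|t| <= `|s|) -> {within `[a, b], continuous g}.
  move=> abs; apply: derivable_within_continuous => t; rewrite in_itv /= => /abs/gd.
  by case.
have [s0|s0] := leP 0 s.
  have bd t : 0 <= t <= s -> `|t| <= `|s| by move=> /andP[t0 ts]; rewrite !ger0_norm.
  have [] := @MVT_segment R g df 0 s s0 _ (gc _ _ bd).
    by move=> t; rewrite in_itv /= => /andP[/ltW t0 /ltW ts]; apply/gd/bd/andP.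
  move=> t; rewrite in_itv /= => /bd ts; rewrite g0 subr0 mulrC => E.
  by exists t.
have bd t : s <= t <= 0 -> `|t| <= `|s| by move=> /andP[st t0]; rewrite !ler0_norm ?lerN2 // ltW.
have [] := @MVT_segment R g df s 0 (ltW s0) _ (gc _ _ bd).
  by move=> t; rewrite in_itv /= => /andP[/ltW t0 /ltW ts]; apply/gd/bd/andP.
move=> t; rewrite in_itv /= => /bd ts; rewrite g0 sub0r mulrN => E.
by exists t => //; rewrite -[LHS]opprB E mulrC opprK.
Qed.

Lemma norm_rV_le x (e : R) : 0 <= e -> (`|x| <= e) <-> (forall i, `|x 0 i| <= e).
Proof.
move=> e0; rewrite [`|x|]mx_normrE; split=> [xe i|xe].
  by apply: le_trans xe; apply: (le_bigmax _ (fun ij => `|x ij.1 ij.2|) (0, i)).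
by apply: bigmax_le => // -[i j] _; rewrite ord1.
Qed.

Lemma coord_le_norm x (i : 'I_N) : `|x 0 i| <= `|x|.
Proof. by have /norm_rV_le := lexx `|x|; apply. Qed.

(** Moving from [x] to [x + h] one coordinate at a time, each step is controlled by
    the mean value theorem. With [c i] the partial derivatives at [x] this is the
    differentiability of [f] at [x]. *)
Lemma increment_estimate f x (r e : R) (c : 'I_N -> R) (df : 'I_N -> V -> R) :
  (forall y i, `|y - x| < r -> is_derive y 'e_i f (df i y)) ->
  (forall y i, `|y - x| < r -> `|df i y - c i| <= e) ->
  forall h, `|h| < r ->
  `|f (x + h) - f x - \sum_i h 0 i * c i| <= e * \sum_i `|h 0 i|.
Proof.
move=> fd fc h hr.
pose H j : V := \row_i (if (i < j)%N then h 0 i else 0).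
suff S j : (j <= N)%N -> `|f (x + H j) - f x - \sum_(i < N | (i < j)%N) h 0 i * c i| <=
      e * \sum_(i < N | (i < j)%N) `|h 0 i|.
  have := S N (leqnn N).
  have -> : H N = h by apply/rowP => i; rewrite mxE ltn_ord.
  have E (F : 'I_N -> R) : \sum_(i < N | (i < N)%N) F i = \sum_i F i.
    by apply: eq_bigl => i; rewrite ltn_ord.
  by rewrite !E.
elim: j => [_|j IH jN].
  rewrite !big_pred0 // (_ : H 0%N = 0); last by apply/rowP => i; rewrite !mxE.
  by rewrite addr0 !subrr normr0 mulr0.
have {}IH := IH (ltnW jN); pose i := Ordinal jN.
have HS : H j.+1 = H j + h 0 i *: 'e_i.
  apply/rowP => l; rewrite !mxE eqxx /= ltnS leq_eqVlt; case: (l =P i) => [->|li] /=.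
    by rewrite eqxx ltnn mulr1 add0r.
  by rewrite mulr0 addr0; case: (nat_of_ord l =P j) => [lj|//]; case: li; exact: val_inj.
have Hr (t : R) : `|t| <= `|h 0 i| -> `|(x + H j + t *: 'e_i) - x| < r.
  move=> th; rewrite (_ : x + H j + t *: 'e_i - x = H j + t *: 'e_i); last first.
    by apply/rowP => l; rewrite !mxE; ring.
  apply: le_lt_trans hr.
  apply/norm_rV_le => // l; rewrite !mxE eqxx /=; case: (l =P i) => [->|li].
    by rewrite ltnn add0r mulr1 (le_trans th) ?coord_le_norm.
  by rewrite mulr0 addr0; case: ifP; rewrite ?normr0 ?coord_le_norm.
have [t th E] := MVT_line (fun t tl => fd _ i (Hr t tl)).
have iE (F : 'I_N -> R) : \sum_(l < N | (l < j.+1)%N) F l = F i + \sum_(l < N | (l < j)%N) F l.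
  rewrite (bigD1 i) //=; congr (_ + _); apply: eq_bigl => l.
  by rewrite ltnS ltn_neqAle -val_eqE andbC.
rewrite !iE HS addrA; set A := \sum_(_ < _ | _) _ in IH *; set B := \sum_(_ < _ | _) _ in IH *.
have -> : f (x + H j + h 0 i *: 'e_i) - f x - (h 0 i * c i + A) =
  h 0 i * (df i (x + H j + t *: 'e_i) - c i) + (f (x + H j) - f x - A).
  by rewrite mulrBr -E; ring.
rewrite [leRHS]mulrDr; apply: le_trans (ler_normD _ _) _; apply: lerD => //.
by rewrite normrM mulrC; apply: ler_wpM2r => //; exact/fc/Hr.
Qed.

Lemma continuous_atP f x : {for x, continuous f} <->
  (forall e : R, 0 < e -> \forall y \near x, `|f y - f x| <= e).
Proof.
split=> fx.
  move=> e e0; have /(@cvgrPdist_le _ _ _ _ (nbhs_filter x))/(_ e e0) := fx.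
  by apply: filterS => y; rewrite distrC.
apply/(@cvgrPdist_le _ _ _ _ (nbhs_filter x)) => e /fx.
by apply: filterS => y; rewrite distrC.
Qed.

Definition C1_at f x := (\forall y \near x, forall i, derivable f y 'e_i) /\
  (forall i, {for x, continuous (partial i f)}).

Lemma C1_expansion f x (e : R) : C1_at f x -> 0 < e ->
  exists2 r : R, 0 < r & forall h, `|h| < r ->
  `|f (x + h) - f x - \sum_i h 0 i * partial i f x| <= e * \sum_i `|h 0 i|.
Proof.
move=> [fd fc] e0.
have : \forall y \near x, forall i, derivable f y 'e_i /\ `|partial i f y - partial i f x| <= e.
  have fc' : \forall y \near x, forall i, `|partial i f y - partial i f x| <= e.
    apply: (@filter_forall _ _ (fun i y => `|partial i f y - partial i f x| <= e) (nbhs x)) => i.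
    by have /continuous_atP := fc i; exact.
  by near=> y; move=> i; split; move: i; near: y.
move=> /near_norm[r r0 fr]; exists r => // h hr.
apply: (@increment_estimate f x r e (fun i => partial i f x) (fun i => partial i f)) => //.
  by move=> y i /fr/(_ i)[fy _]; exact: derivableP.
by move=> y i /fr/(_ i)[].
Unshelve. all: by end_near. Qed.

Lemma C1_is_derive f x v : C1_at f x ->
  is_derive x v f (\sum_i v 0 i * partial i f x).
Proof.
move=> fC; set d := \sum_i _.
suff H : h^-1 *: ((f \o shift x) (h *: v) - f x) @[h --> 0^'] --> (d : R).
  by split; [apply/cvg_ex; exists d | exact: cvg_lim].
apply/cvgrPdist_le => e e0.
pose S := \sum_i `|v 0 i|.
have S0 : 0 <= S by exact: sumr_ge0.
have [r r0 fr] := C1_expansion fC (divr_gt0 e0 (ltr_pwDl ltr01 S0)).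
have v0 : 0 < `|v| + 1 by rewrite ltr_wpDl.
have : \forall h \near (0:R), `|h| < r / (`|v| + 1).
  by apply/near_norm; exists (r / (`|v| + 1)) => [|h]; rewrite ?divr_gt0 ?subr0.
move=> /nbhs_dnbhs; have := nbhs_dnbhs_neq (0 : R); apply: filterS2 => h h0 hr.
have hvr : `|h *: v| < r.
  rewrite normrZ; apply: le_lt_trans (_ : `|h| * (`|v| + 1) < r).
    by rewrite ler_wpM2l // lerDl.
  by rewrite -ltr_pdivlMr.
have := fr _ hvr.
have -> : \sum_i (h *: v) 0 i * partial i f x = h * d.
  by rewrite mulr_sumr; apply: eq_bigr => i _; rewrite mxE mulrA.
have -> : \sum_i `|(h *: v) 0 i| = `|h| * S.
  by rewrite mulr_sumr; apply: eq_bigr => i _; rewrite mxE normrM.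
move=> E.
have -> : d - h^-1 *: ((f \o shift x) (h *: v) - f x) =
  - (h^-1 * (f (x + h *: v) - f x - h * d)).
  rewrite /= [h *: v + x]addrC; change (d - h^-1 * (f (x + h *: v) - f x) =
   - (h^-1 * (f (x + h *: v) - f x - h * d))); by field.
rewrite normrN normrM normfV mulrC ler_pdivrMr ?normr_gt0 //.
apply: le_trans E _; rewrite mulrCA mulrC; apply: ler_wpM2r => //.
rewrite -mulrA ger_pMr // mulrC ler_pdivrMr ?ltr_pwDl //.
by rewrite mul1r lerDr.
Qed.

Lemma C1_continuous f x : C1_at f x -> {for x, continuous f}.
Proof.
move=> fC; apply/continuous_atP => e e0; have [r r0 fr] := C1_expansion fC ltr01.
pose K := \sum_(i < N) (1 + `|partial i f x|).
have K0 : 0 <= K by apply: sumr_ge0 => i _; rewrite addr_ge0.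
apply: (proj2 (near_norm x _)); exists (Num.min r (e / (1 + K))).
  by rewrite lt_min r0 divr_gt0 // ltr_pwDl.
move=> y; rewrite lt_min => /andP[/fr yr ye].
move: yr; rewrite subrKC => yr.
have -> : f y - f x = (f y - f x - \sum_i (y - x) 0 i * partial i f x)
   + \sum_i (y - x) 0 i * partial i f x by rewrite subrK.
apply: le_trans (ler_normD _ _) _.
apply: le_trans (lerD yr (ler_norm_sum _ _ _)) _.
rewrite mul1r -big_split /=.
apply: (@le_trans _ _ (`|y - x| * K)).
  rewrite mulr_sumr; apply: ler_sum => i _; rewrite mulrDr mulr1 normrM.
  by apply: lerD; rewrite ?ler_wpM2r // coord_le_norm.
apply: (@le_trans _ _ (`|y - x| * (1 + K))); first by rewrite ler_wpM2l // lerDr.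
by rewrite -ler_pdivlMr ?ltr_pwDl // ltW.
Qed.

Lemma C2_near_C1 f x : C2_near f x -> \forall y \near x,
  C1_at f y /\ forall i, C1_at (partial i f) y.
Proof.
move=> /near_join; apply: filterS => y fy.
have fy0 := nbhs_singleton fy.
split=> [|i]; split.
- by apply: filterS fy => z [zf _] i; have [] := zf i.
- by case: fy0 => h _ i; have [] := h i.
- by apply: filterS fy => z [_ zf] j; have [] := zf j i.
- by case: fy0 => _ h j; have [] := h j i.
Qed.

Lemma C2_near_nearby f x : C2_near f x -> \forall y \near x, C2_near f y.
Proof. exact: near_join. Qed.

Lemma norm_basis_le (i : 'I_N) : `|'e_i : V| <= 1.
Proof.
by apply/norm_rV_le => // j; rewrite mxE eqxx /=; case: eqP; rewrite ?normr1 ?normr0.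
Qed.

Lemma is_derive_translate f y v w d :
  is_derive (y + w) v f d -> is_derive y v (fun z => f (z + w)) d.
Proof.
have E : (fun h : R => h^-1 *: (((fun z => f (z + w)) \o shift y) (h *: v) - f (y + w))) =
  (fun h : R => h^-1 *: ((f \o shift (y + w)) (h *: v) - f (y + w))).
  by apply/funext => h /=; rewrite addrA.
by case=> fd dE; split; rewrite /derivable /derive E.
Qed.

(** The second difference quotient is a mixed derivative at a nearby point, in either
    order of differentiation, since the left-hand side is symmetric in [i] and [j];
    this gives the symmetry of the Hessian. *)
Lemma second_difference f x (r s : R) (i j : 'I_N) : 0 < s -> 2 * s < r ->
  (forall y, `|y - x| < r -> C1_at f y /\ forall l, C1_at (partial l f) y) ->
  exists2 p, `|p - x| <= 2 * s &
   f (x + s *: 'e_i + s *: 'e_j) - f (x + s *: 'e_i) - (f (x + s *: 'e_j) - f x) =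
   s * (s * partial j (partial i f) p).
Proof.
move=> s0 sr fC.
have near_x (t u : R) : `|t| <= s -> `|u| <= s ->
    `|(x + t *: 'e_i + u *: 'e_j) - x| <= 2 * s.
  move=> ts us; have -> : x + t *: 'e_i + u *: 'e_j - x = t *: 'e_i + u *: 'e_j.
    by apply/rowP => l; rewrite !mxE; ring.
  apply: le_trans (ler_normD _ _) _; rewrite !normrZ mulr_natl mulr2n; apply: lerD;
  by apply: le_trans (ler_piMr _ (norm_basis_le _)) _.
have d1 y l : `|y - x| <= 2 * s -> is_derive y 'e_l f (partial l f y).
  move=> ys; have [[/nbhs_singleton fd _] _] := fC y (le_lt_trans ys sr).
  exact: derivableP.
have d2 y l m : `|y - x| <= 2 * s -> is_derive y 'e_l (partial m f) (partial l (partial m f) y).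
  move=> ys; have [_ /(_ m)[/nbhs_singleton fd _]] := fC y (le_lt_trans ys sr).
  exact: derivableP.
have s_s : `|s| <= s by rewrite gtr0_norm.
have z_s : `|0 : R| <= s by rewrite normr0 ltW.
pose F y := f (y + s *: 'e_j) - f y.
have [|t] := @MVT_line F x 'e_i s (fun t => partial i f (x + t *: 'e_i + s *: 'e_j) -
    partial i f (x + t *: 'e_i)).
  move=> t ts; rewrite (gtr0_norm s0) in ts; have h2 : is_derive (x + t *: 'e_i) 'e_i f (partial i f (x + t *: 'e_i)).
    by apply: d1; have := near_x t 0 ts z_s; rewrite scale0r addr0.
  have h1 : is_derive (x + t *: 'e_i) 'e_i (fun y => f (y + s *: 'e_j))
      (partial i f (x + t *: 'e_i + s *: 'e_j)).
    by apply: is_derive_translate; apply: d1; exact: near_x.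
  exact: (is_deriveB h1 h2).
rewrite (gtr0_norm s0) => ts E.
have [|u] := @MVT_line (partial i f) (x + t *: 'e_i) 'e_j s
   (fun u => partial j (partial i f) (x + t *: 'e_i + u *: 'e_j)).
  by move=> u us; rewrite (gtr0_norm s0) in us; apply: d2; exact: near_x.
rewrite (gtr0_norm s0) => us E'.
exists (x + t *: 'e_i + u *: 'e_j); first exact: near_x.
by rewrite -E' -E /F; ring.
Qed.

Lemma hessian_symmetric f x : C2_near f x -> (hessian f x)^T = hessian f x.
Proof.
move=> fC; apply/matrixP => i j; rewrite !mxE.
have /near_norm[r r0 fr] := C2_near_C1 fC.
apply/eqP; rewrite -subr_eq0 -normr_le0; apply/ler_addgt0Pl => e e0; rewrite addr0.
have e2 : 0 < e / 2 by rewrite divr_gt0.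
have cont a b : \forall y \near x, `|partial a (partial b f) y - partial a (partial b f) x| <= e / 2.
  have [_ /(_ a b)[_]] := nbhs_singleton fC.
  by move=> /continuous_atP/(_ _ e2).
have /near_norm[r1 r10 c1] := cont i j; have /near_norm[r2 r20 c2] := cont j i.
pose s := Num.min r (Num.min r1 r2) / 3.
have m0 : 0 < Num.min r (Num.min r1 r2) by rewrite !lt_min r0 r10 r20.
have s0 : 0 < s by rewrite divr_gt0.
have : 2 * s < Num.min r (Num.min r1 r2) by rewrite /s; lra.
rewrite !lt_min => /and3P[sr sr1 sr2].
have [p px pE] := second_difference i j s0 sr fr.
have [q qx qE] := second_difference j i s0 sr fr.
have pq : partial j (partial i f) p = partial i (partial j f) q.
  apply: (mulfI (lt0r_neq0 s0)); apply: (mulfI (lt0r_neq0 s0)).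
  rewrite -[LHS]pE -[RHS]qE (addrAC x (s *: 'e_i) (s *: 'e_j)).
  move: (f (x + s *: 'e_j + s *: 'e_i)) (f (x + s *: 'e_i)) (f (x + s *: 'e_j)) (f x).
  by move=> a b c d; ring.
have := c2 p (le_lt_trans px sr2); have := c1 q (le_lt_trans qx sr1).
rewrite pq.
move: (partial i (partial j f) q) (partial i (partial j f) x) (partial j (partial i f) x).
move=> a b c h1 h2; have -> : c - b = (a - b) - (a - c) by ring.
by apply: le_trans (ler_normB _ _) _; rewrite (splitr e) lerD.
Qed.

(** Restrict [f] to a line through [x]: the first derivative vanishes at the maximum,
    and if the second one were positive the first would be positive just after it. *)
Lemma local_max_derivatives f x : C2_near f x ->
  (\forall y \near x, f y <= f x) ->
  (forall i, partial i f x = 0) /\ forall v : 'I_N -> R, qform (hessian f x) v <= 0.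
Proof.
move=> fC fmax.
have : \forall y \near x, f y <= f x /\ (C1_at f y /\ forall i, C1_at (partial i f) y).
  by apply: filterS2 fmax (C2_near_C1 fC).
move=> /near_norm[r r0 fr].
suff H (v : V) : \sum_i v 0 i * partial i f x = 0 /\
    \sum_i v 0 i * (\sum_j v 0 j * partial j (partial i f) x) <= 0.
  split=> [i|v].
    have [+ _] := H 'e_i; rewrite (bigD1 i) //= big1 => [|j ji]; last first.
      by rewrite mxE (negPf ji) andbF mul0r.
    by rewrite mxE !eqxx mul1r addr0.
  have [_] := H (\row_i v i); apply: le_trans; rewrite /qform exchange_big /=.
  rewrite le_eqVlt; apply/orP; left; apply/eqP.
  apply: eq_bigr => i _; rewrite mulr_sumr; apply: eq_bigr => j _.
  by rewrite !mxE; ring.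
pose g (t : R) := f (x + t *: v).
pose g1 (t : R) := \sum_i v 0 i * partial i f (x + t *: v).
have v0 : 0 < `|v| + 1 by rewrite ltr_wpDl.
pose r' := r / (`|v| + 1); have r'0 : 0 < r' by rewrite divr_gt0.
have tr (t : R) : `|t| < r' -> `|(x + t *: v) - x| < r.
  rewrite ltr_pdivlMr // [x + _]addrC addrK normrZ; apply: le_lt_trans.
  by rewrite ler_wpM2l // lerDl.
have gmax t : `|t| < r' -> g t <= g 0.
  by rewrite /g scale0r addr0 => /tr/fr[].
have gd (t : R) : `|t| < r' -> is_derive t (1 : R) g (g1 t).
  by move=> /tr/fr[_ [fC1 _]]; apply: is_derive_line; exact: C1_is_derive.
have z : `|0 : R| < r' by rewrite normr0.
have g10 : g1 0 = 0.
  have [_ <-] := gd _ z.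
  have [||||_ //] := @derive1_at_max R g (- r') r' 0.
  - by rewrite ge0_cp // ltW.
  - by move=> t; rewrite in_itv /= -ltr_norml => /gd[].
  - by rewrite in_itv /= oppr_lt0 r'0.
  - by move=> t; rewrite in_itv /= -ltr_norml; exact: gmax.
have g1d : is_derive (0 : R) (1 : R) g1 (\sum_i v 0 i * (\sum_j v 0 j * partial j (partial i f) x)).
  have -> : g1 = \sum_i (fun t : R => v 0 i * partial i f (x + t *: v)).
    by apply/funext => t; rewrite fct_sumE.
  apply: is_derive_sum => i; apply: (@is_deriveZ _ _ _ (fun t : R => partial i f (x + t *: v)) (v 0 i)).
  apply: is_derive_line; rewrite scale0r addr0; apply: C1_is_derive.
  have xx : `|x - x| < r by rewrite subrr normr0.
  by have [_ [_]] := fr x xx; apply.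
split; first by move: g10; rewrite /g1 scale0r addr0.
rewrite leNgt; apply/negP; set D := \sum_i _ in g1d * => D0.
have [dd dE] := g1d.
have : \forall h \near 0^', 0 < h^-1 *: (g1 (h *: 1 + 0) - g1 0).
  have : (h^-1 *: ((g1 \o shift 0) (h *: 1) - g1 0) @[h --> 0^'] --> (D : R)).
    by rewrite -dE; exact: dd.
  by move=> /cvgr_gt/(_ _ D0).
move=> /(@near_norm R R 0)[d d0 hd].
pose t := Num.min (d / 2) (r' / 2).
have t0 : 0 < t by rewrite lt_min !divr_gt0.
have td : t < d by rewrite gt_min; apply/orP; left; lra.
have tr' : t < r' by rewrite gt_min; apply/orP; right; lra.
have bd (u : R) : 0 <= u -> u <= t -> `|u| < r' by move=> u0 /le_lt_trans-/(_ _ tr'); rewrite ger0_norm.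
have [] := @MVT R g g1 0 t t0.
- by move=> u; rewrite in_itv /= => /andP[/ltW u0 /ltW ut]; exact/gd/bd.
- apply: derivable_within_continuous => u; rewrite in_itv /= => /andP[u0 ut].
  by have [] := gd u (bd _ u0 ut).
move=> u; rewrite in_itv /= => /andP[u0 ut] E.
have := gmax t (bd _ (ltW t0) (lexx t)); rewrite -subr_le0 E subr0 leNgt => /negP; apply.
rewrite mulr_gt0 //.
have := hd u; rewrite subr0 gtr0_norm // => /(_ (lt_trans ut td) (lt0r_neq0 u0)).
by rewrite g10 subr0 addr0 [u *: 1]mulr1 => H; rewrite -(pmulr_rgt0 _ (_ : 0 < u^-1)) ?invr_gt0.
Qed.

Implicit Types (g : V -> R) (df dg : 'I_N -> V -> R) (ddf ddg : 'I_N -> 'I_N -> V -> R).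

(** A neighbourhood version of being of class [C^2] that carries the derivatives along,
    so that the rules of calculus also compute gradients and Hessians. *)
Definition C2_with f df ddf x := \forall y \near x,
  [/\ forall i, is_derive y 'e_i f (df i y),
      forall i, {for y, continuous (df i)},
      forall i j, is_derive y 'e_i (df j) (ddf i j y) &
      forall i j, {for y, continuous (ddf i j)}].

Lemma continuous_near_eq f g x : (\forall y \near x, f y = g y) ->
  {for x, continuous f} -> {for x, continuous g}.
Proof.
move=> fg /continuous_atP fx; apply/continuous_atP => e /fx; have fgx := nbhs_singleton fg.
by apply: filterS2 fg => y fgy; rewrite -fgx -fgy.
Qed.

Lemma C2_with_near f df ddf x : C2_with f df ddf x ->
  [/\ C2_near f x, forall i, partial i f x = df i x &
      forall i j, partial i (partial j f) x = ddf i j x].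
Proof.
move=> H.
have d1 y : C2_with f df ddf y -> forall i, partial i f y = df i y.
  by move=> /nbhs_singleton[fy _ _ _] i; have [] := fy i.
have d1n y i : C2_with f df ddf y -> \forall z \near y, df i z = partial i f z.
  by move=> /near_join; apply: filterS => z /d1.
have d2 y : C2_with f df ddf y -> forall i j, partial i (partial j f) y = ddf i j y.
  move=> fy i j; have /nbhs_singleton[_ _ /(_ i j)[_ <-] _] := fy.
  by apply: near_eq_derive; apply: filterS (d1n _ j fy) => z ->.
have d2n y i j : C2_with f df ddf y -> \forall z \near y, ddf i j z = partial i (partial j f) z.
  by move=> /near_join; apply: filterS => z /d2.
split; [|exact: d1|exact: d2].
move/near_join: H; apply: filterS => y fy; split=> [i|i j].
  have /nbhs_singleton[/(_ i)[fd _] /(_ i) fc _ _] := fy; split=> //.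
  exact: continuous_near_eq (d1n _ i fy) fc.
have /nbhs_singleton[_ _ /(_ i j)[fd _] /(_ i j) fc] := fy; split.
  exact: near_eq_derivable (d1n _ j fy) fd.
exact: continuous_near_eq (d2n _ i j fy) fc.
Qed.

Lemma C2_near_with f x : C2_near f x ->
  C2_with f (fun i => partial i f) (fun i j => partial i (partial j f)) x.
Proof.
apply: filterS => y [h1 h2]; split.
- by move=> i; have [fd _] := h1 i; exact: derivableP.
- by move=> i; have [] := h1 i.
- by move=> i j; have [fd _] := h2 i j; exact: derivableP.
- by move=> i j; have [] := h2 i j.
Qed.

Lemma C2_withD f df ddf g dg ddg x : C2_with f df ddf x -> C2_with g dg ddg x ->
  C2_with (fun y => f y + g y) (fun i y => df i y + dg i y)
          (fun i j y => ddf i j y + ddg i j y) x.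
Proof.
apply: filterS2 => y [f1 f2 f3 f4] [g1 g2 g3 g4]; split=> [i|i|i j|i j].
- exact: (is_deriveD (f1 i) (g1 i)).
- exact: (continuousD (f2 i) (g2 i)).
- exact: (is_deriveD (f3 i j) (g3 i j)).
- exact: (continuousD (f4 i j) (g4 i j)).
Qed.

Lemma C2_withM f df ddf g dg ddg x :
  C2_with f df ddf x -> C2_with g dg ddg x ->
  C2_with (fun y => f y * g y) (fun i y => f y * dg i y + g y * df i y)
     (fun i j y => (f y * ddg i j y + dg j y * df i y) + (g y * ddf i j y + df j y * dg i y)) x.
Proof.
move=> Hf Hg.
have cf : \forall y \near x, {for y, continuous f}.
  have [fC _ _] := C2_with_near Hf.
  by apply: filterS (C2_near_C1 fC) => y [/C1_continuous].
have cg : \forall y \near x, {for y, continuous g}.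
  have [gC _ _] := C2_with_near Hg.
  by apply: filterS (C2_near_C1 gC) => y [/C1_continuous].
apply: filterS2 (filterI Hf Hg) (filterI cf cg) => y.
move=> [[f1 f2 f3 f4] [g1 g2 g3 g4]] [cfy cgy]; split=> [i|i|i j|i j].
- exact: (is_deriveM (f1 i) (g1 i)).
- exact: (continuousD (continuousM cfy (g2 i)) (continuousM cgy (f2 i))).
- exact: (is_deriveD (is_deriveM (f1 i) (g3 i j)) (is_deriveM (g1 i) (f3 i j))).
- apply: (continuousD (continuousD (continuousM cfy (g4 i j)) (continuousM (g2 j) (f2 i)))).
  exact: (continuousD (continuousM cgy (f4 i j)) (continuousM (f2 j) (g2 i))).
Qed.

Lemma C2_with_cst (c : R) x : C2_with (fun=> c) (fun _ _ => 0) (fun _ _ _ => 0) x.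
Proof.
by have := @filterT _ (nbhs x) (nbhs_filter x); apply: filterS => y _; split=> *; try exact: cst_continuous; exact: is_derive_cst.
Qed.

Lemma C2_withZ (c : R) f df ddf x : C2_with f df ddf x ->
  C2_with (fun y => c * f y) (fun i y => c * df i y) (fun i j y => c * ddf i j y) x.
Proof.
apply: filterS => y [f1 f2 f3 f4]; split=> [i|i|i j|i j].
- exact: (is_deriveZ c (f1 i)).
- exact: (continuousM (@cst_continuous _ _ c y) (f2 i)).
- exact: (is_deriveZ c (f3 i j)).
- exact: (continuousM (@cst_continuous _ _ c y) (f4 i j)).
Qed.

(** All explicit test functions are built from sums of one-variable polynomials in the
    coordinates, for which mixed derivatives vanish. *)
Definition separable (P : 'I_N -> {poly R}) : V -> R := fun y => \sum_i (P i).[y 0 i].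

Lemma is_derive_separable P i y :
  is_derive y 'e_i (separable P) ((P i)^`()%R.[y 0 i]).
Proof.
have E : (fun h : R => h^-1 *: ((separable P \o shift y) (h *: 'e_i) - separable P y)) =
  (fun h : R => h^-1 *: ((horner (P i) \o shift (y 0 i)) (h *: 1) - (P i).[y 0 i])).
  apply/funext => h; congr (_ *: _); rewrite /separable /= -sumrB (bigD1 i) //= big1.
    by rewrite addr0 !mxE !eqxx /= [h *: 1]mulr1 mulr1.
  by move=> j ji; rewrite !mxE (negPf ji) andbF mulr0 add0r subrr.
have fd : derivable (horner (P i)) (y 0 i) (1 : R) by exact: derivable_horner.
have dE : ('D_1 (horner (P i)) (y 0 i) = (P i)^`()%R.[y 0 i]).
  by rewrite derivE derive1E.
by split; [move: fd|move: dE]; rewrite /derivable /derive E.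
Qed.

Lemma C2_with_separable P x : C2_with (separable P) (fun i y => (P i)^`()%R.[y 0 i])
  (fun i j y => if i == j then (P i)^`()%R^`()%R.[y 0 i] else 0) x.
Proof.
have cont (p : {poly R}) (i : 'I_N) y : {for y, continuous (fun z : V => p.[z 0 i])}.
  apply: (@continuous_comp _ _ _ (fun z : V => z 0 i) (horner p)).
    exact: coord_continuous.
  exact: continuous_horner.
have := @filterT _ (nbhs x) (nbhs_filter x); apply: filterS => y _; split=> [i|i|i j|i j].
- exact: is_derive_separable.
- exact: cont.
- have -> : (fun y : V => (P j)^`()%R.[y 0 j]) =
      separable (fun l => if l == j then (P j)^`()%R else 0).
    apply/funext => z; rewrite /separable (bigD1 j) //= eqxx big1 ?addr0 //.
    by move=> l /negPf ->; rewrite horner0.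
  apply: is_derive_eq; first exact: is_derive_separable.
  by have [->|ij] := eqVneq i j; rewrite ?eqxx ?(negPf ij) ?deriv0 ?horner0.
- by case: eqP => _; [exact: cont|exact: cst_continuous].
Qed.

End calculus.

(** * Semicontinuity and relaxed limits *)

Section semicontinuity.
Context {R : realType} {N : nat}.
Notation V := 'rV[R]_N.
Implicit Types (f g u : V -> R) (x y : V) (K L : set V).

Lemma lsc_onP K u : lsc_on K u <->
  (forall x, K x -> forall a : R, a < u x -> \forall y \near x, K y -> a < u y).
Proof.
split=> [uK x Kx a ax|uK x a ax].
  have [W xW Wu] := uK x a ax.
  have {}xW : within K (nbhs x) W by rewrite (nbhs_subspace_in Kx).
  move: xW; rewrite /within /=; apply: filterS => y yW Ky.
  by rewrite -lte_fin; exact/Wu/yW.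
have [Kx|nKx] := pselect (K x); last first.
  exists [set x]; last by move=> y ->.
  have : globally [set x] [set x] by move=> y.
  by rewrite (@nbhs_subspace_out V K x nKx) => xx; exact xx.
exists [set y | a < u y]; last by move=> y; rewrite lte_fin.
suff : within K (nbhs (x : V)) [set y | a < u y].
  by rewrite (@nbhs_subspace_in V K x Kx) => xV; exact xV.
by apply: uK => //; rewrite -lte_fin.
Qed.

(** A condition that holds for all small parameters locally uniformly on a compact set
    holds there for one common parameter. *)
Lemma compact_uniform K (P : R -> V -> Prop) : compact K ->
  (forall x, K x -> exists2 e : R, 0 < e &
     \forall y \near x, forall d, 0 < d <= e -> P d y) ->
  exists2 e : R, 0 < e & forall d, 0 < d <= e -> forall y, K y -> P d y.
Proof.
move=> /compact_near_coveringP cK KP.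
have := cK R (0 : R)^'+ (fun d y => forall d', 0 < d' <= d -> P d' y) _.
have -> : (forall x, K x ->
  \forall x' \near x & d \near (0 : R)^'+, forall d', 0 < d' <= d -> P d' x') = True.
  apply/propext; split=> // _ x /KP[e e0 eP].
  exists ([set y | forall d, 0 < d <= e -> P d y], [set d | d <= e]) => /=.
    by split=> //; exact: nbhs_right_le.
  move=> [y d] /= [yP de] d' /andP[d'0 d'd]; apply: yP.
  by rewrite d'0 (le_trans d'd).
move=> /(_ _ I) H.
have [e [e0 eP]] : exists e : R, 0 < e /\ K `<=` (fun y => forall d', 0 < d' <= e -> P d' y).
  near (0 : R)^'+ => e; exists e; split; first by near: e; exact: nbhs_right_gt.
  by near: e; exact: H.
by exists e => // d de y /eP; exact.
Unshelve. all: by end_near. Qed.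

(** The function is bounded below and its infimum is attained; both follow by
    covering, applied to [- 1 / d <= u] and to [inf u + d <= u]. *)
Lemma lsc_min K u : compact K -> K !=set0 -> lsc_on K u ->
  exists2 x, K x & forall y, K y -> u x <= u y.
Proof.
move=> cK [x0 Kx0] /lsc_onP uK.
have [M uM] : exists M, forall y, K y -> M <= u y.
  have [|e e0 eP] := @compact_uniform K (fun d y => K y -> - d^-1 <= u y) cK.
    move=> x Kx; pose c := `|u x - 1| + 1.
    have c0 : 0 < c by rewrite ltr_wpDl.
    exists c^-1; first by rewrite invr_gt0.
    have ux : u x - 1 < u x by rewrite gtrDl ltrN10.
    apply: filterS (uK x Kx _ ux) => y uy d /andP[d0 dc] Ky.
    apply: ltW; apply: le_lt_trans (uy Ky).
    have : c <= d^-1 by rewrite -[c]invrK lef_pV2 // posrE // invr_gt0.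
    have := ler_norm (- (u x - 1)); rewrite normrN /c; lra.
  by exists (- e^-1) => y Ky; apply: (eP e _ y Ky Ky); rewrite e0 lexx.
pose m := inf [set u y | y in K].
have hi : has_inf [set u y | y in K].
  by split; [exists (u x0), x0 | exists M => _ [y Ky <-]; exact: uM].
have mle y : K y -> m <= u y by move=> Ky; apply: ge_inf; [case: hi|exists y].
apply: contrapT => noatt.
have lt_m x : K x -> m < u x.
  move=> Kx; rewrite lt_neqAle mle // andbT; apply/eqP => mx.
  by apply: noatt; exists x => // y Ky; rewrite -mx mle.
have [|e e0 eP] := @compact_uniform K (fun d y => K y -> m + d <= u y) cK.
  move=> x Kx; exists ((u x - m) / 2); first by rewrite divr_gt0 // subr_gt0 lt_m.
  have ux : m + (u x - m) / 2 < u x by have := lt_m x Kx; lra.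
  apply: filterS (uK x Kx _ ux) => y uy d /andP[d0 dx] Ky.
  by apply: ltW; apply: le_lt_trans (uy Ky); rewrite lerD2l.
suff : m + e <= m by rewrite gerDl leNgt e0.
apply: lb_le_inf; first by exists (u x0), x0.
by move=> _ [y Ky <-]; apply: (eP e) => //; rewrite e0 lexx.
Qed.

Lemma lsc_on_subset K L u : K `<=` L -> lsc_on L u -> lsc_on K u.
Proof.
move=> KL /lsc_onP uL; apply/lsc_onP => x /KL Lx a ax.
by apply: filterS (uL x Lx a ax) => y yu /KL.
Qed.

Lemma lsc_on_add K u g : lsc_on K u -> (forall x, K x -> {for x, continuous g}) ->
  lsc_on K (fun x => u x + g x).
Proof.
move=> /lsc_onP uK gK; apply/lsc_onP => x Kx a ax.
pose e := (u x + g x - a) / 2; have e0 : 0 < e by rewrite divr_gt0 // subr_gt0.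
have /continuous_atP/(_ _ e0) gx := gK x Kx.
have ux : u x - e < u x by rewrite gtrBl.
apply: filterS2 (uK x Kx _ ux) gx => y yu /ler_normlP[h _] Ky.
by move: (yu Ky) h; rewrite /e opprB; lra.
Qed.

Lemma compact_ball (x : V) (r : R) : 0 < r -> compact [set y | `|y - x| <= r].
Proof.
move=> r0; have -> : [set y | `|y - x| <= r] = closed_ball x r.
  by rewrite closed_ballE //; apply/seteqP; split=> y; rewrite /closed_ball_ /= distrC.
apply: bounded_closed_compact; last exact: closed_ball_closed.
exists (`|x| + r); split; first exact: num_real.
move=> M hM y; rewrite closed_ballE // /closed_ball_ /= => yx.
have -> : y = x - (x - y) by rewrite opprB addrCA subrr addr0.
by apply: le_trans (ler_normB _ _) _; lra.
Qed.

End semicontinuity.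

Section relaxed.
Context {R : realType} {N : nat}.
Notation V := 'rV[R]_N.
Context (K : set V) (T : R -> V -> R -> Prop) (lo hi : R).
Context (T_mono : forall d e y s, d <= e -> T d y s -> T e y s).
Context (T_lo : forall e y s, T e y s -> lo <= s).
Context (T_hi : forall e y, 0 < e -> K y -> exists2 s, T e y s & s <= hi).

(** [T e y s] says that [s] is one of the values allowed at the point [y] at the
    level [e]; the relaxed limit at [x] is the limit, as [e] tends to 0, of the
    infimum of the values allowed at level [e] at distance less than [e] from [x].
    Taking the supremum of the lower bounds avoids infima of possibly empty sets. *)
Definition relaxed_bound x : set R :=
  [set m | exists2 e : R, 0 < e & forall y s, T e y s -> `|y - x| < e -> m <= s].

Definition relaxed_liminf x : R := sup (relaxed_bound x).

Lemma has_sup_relaxed_bound x : K x -> has_sup (relaxed_bound x).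
Proof.
move=> Kx; split; first by exists lo, 1 => // y s /T_lo.
exists hi => m [e e0 em]; have [s Ts] := T_hi e0 Kx; apply: le_trans.
by apply: em Ts _; rewrite subrr normr0.
Qed.

Lemma relaxed_liminf_gt x a : K x -> a < relaxed_liminf x ->
  exists2 e : R, 0 < e & forall y s, T e y s -> `|y - x| < e -> a <= s.
Proof.
move=> Kx ax.
have [m [e e0 em] am] := sup_gt (proj1 (has_sup_relaxed_bound Kx)) ax.
by exists e => // y s Ts yx; apply: le_trans (ltW am) (em y s Ts yx).
Qed.

Lemma le_relaxed_liminf x m e : K x -> 0 < e ->
  (forall y s, T e y s -> `|y - x| < e -> m <= s) -> m <= relaxed_liminf x.
Proof.
by move=> Kx e0 em; apply: ub_le_sup; [case: (has_sup_relaxed_bound Kx)|exists e].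
Qed.

Lemma relaxed_liminf_le x s : K x -> (forall e, 0 < e -> T e x s) -> relaxed_liminf x <= s.
Proof.
move=> Kx Ts; apply: ge_sup; first by case: (has_sup_relaxed_bound Kx).
by move=> m [e e0]; apply; [exact: Ts|rewrite subrr normr0].
Qed.

Lemma relaxed_liminf_itv x : K x -> lo <= relaxed_liminf x <= hi.
Proof.
move=> Kx; apply/andP; split; first by apply: (@le_relaxed_liminf x lo 1) => // y s /T_lo.
apply: ge_sup; first by case: (has_sup_relaxed_bound Kx).
move=> m [e e0 em]; have [s Ts] := T_hi e0 Kx; apply: le_trans.
by apply: em Ts _; rewrite subrr normr0.
Qed.

Lemma relaxed_liminf_lsc : lsc_on K relaxed_liminf.
Proof.
apply/lsc_onP => x Kx a ax.
have [a' aa' a'x] : exists2 a', a < a' & a' < relaxed_liminf x.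
  by exists ((a + relaxed_liminf x) / 2); lra.
have [e e0 ea'] := relaxed_liminf_gt Kx a'x.
apply/near_norm; exists (e / 2) => [|y yx Ky]; first by rewrite divr_gt0.
apply: lt_le_trans aa' _; apply: (@le_relaxed_liminf y a' (e / 2)); rewrite ?divr_gt0 // => z s Ts zy.
apply: (ea' z); first by apply: T_mono Ts; lra.
have -> : z - x = (z - y) + (y - x) by rewrite subrKA.
by rewrite (le_lt_trans (ler_normD _ _)) // (splitr e) ltrD.
Qed.

Lemma relaxed_liminf_lt x a e : K x -> 0 < e -> relaxed_liminf x < a ->
  exists y s, [/\ T e y s, `|y - x| < e & s < a].
Proof.
move=> Kx e0 xa; apply: contrapT => H.
suff : a <= relaxed_liminf x by rewrite leNgt xa.
apply: (le_relaxed_liminf Kx e0) => y s Ts yx; rewrite leNgt; apply/negP => sa.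
by apply: H; exists y, s.
Qed.

End relaxed.

(** * Ellipticity and continuity of the operator on test functions *)

Section test_functions.
Context {R : realType} {N : nat}.
Notation V := 'rV[R]_N.
Implicit Types (f g phi chi : V -> R) (x y a : V).

Lemma gradientE phi x i : gradient phi x 0 i = partial i phi x.
Proof. by rewrite mxE. Qed.

Lemma hessianE phi x i j : hessian phi x i j = partial i (partial j phi) x.
Proof. by rewrite mxE. Qed.

(** Used to make a contact strict: it dominates [|y - a| ^ 4] for the sup norm, and its
    first and second derivatives vanish at [a]. *)
Definition quartic a : V -> R := separable (fun i => ('X - (a 0 i)%:P) ^+ 4).

Lemma quarticE a y : quartic a y = \sum_i (y 0 i - a 0 i) ^+ 4.
Proof. by apply: eq_bigr => i _; rewrite !hornerE. Qed.

Lemma quartic_center a : quartic a a = 0.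
Proof. by rewrite quarticE big1 // => i _; rewrite subrr expr0n. Qed.

Lemma quartic_ge a y : `|y - a| ^+ 4 <= quartic a y.
Proof.
have q0 : 0 <= quartic a y.
  by rewrite quarticE sumr_ge0 // => i _; rewrite exprn_even_ge0.
have [-> |/mx_norm_neq0[[i0 i] /= ya]] := eqVneq (`|y - a|) 0; first by rewrite expr0n.
have {}ya : `|y - a| = `|y 0 i - a 0 i| by move: ya; rewrite ord1 !mxE.
rewrite ya -normrX ger0_norm ?exprn_even_ge0 // quarticE (bigD1 i) //= lerDl.
by rewrite sumr_ge0 // => j _; rewrite exprn_even_ge0.
Qed.

Lemma quartic_ge0 a y : 0 <= quartic a y.
Proof. by apply: le_trans (quartic_ge a y); rewrite exprn_ge0. Qed.

Definition sqdist a : V -> R := separable (fun i => ('X - (a 0 i)%:P) ^+ 2).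

Lemma sqdistE a y : sqdist a y = enorm (y - a) ^+ 2.
Proof.
rewrite /enorm sqr_sqrtr; last by apply: sumr_ge0 => i _; exact: sqr_ge0.
by apply: eq_bigr => i _; rewrite !hornerE !mxE.
Qed.

Lemma C2_with_sqdist a x : C2_with (sqdist a) (fun i y => 2 * (y 0 i - a 0 i))
  (fun i j _ => if i == j then 2 else 0) x.
Proof.
have d1 i : ((('X - (a 0 i)%:P) ^+ 2)^`() = (2 : R) *: ('X - (a 0 i)%:P))%R.
  by rewrite deriv_exp derivXsubC mul1r expr1 scaler_nat.
have -> : (fun (i : 'I_N) y => 2 * (y 0 i - a 0 i)) =
   (fun i y => ((('X - (a 0 i)%:P) ^+ 2)^`()%R).[y 0 i]).
  by apply/funext => i; apply/funext => y; rewrite d1 !hornerE.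
have -> : (fun (i j : 'I_N) (_ : V) => if i == j then (2 : R) else 0) =
   (fun i j y => if i == j then ((('X - (a 0 i)%:P) ^+ 2)^`()%R^`()%R).[y 0 i] else 0).
  apply/funext => i; apply/funext => j; apply/funext => y; case: eqP => // _.
  by rewrite d1 derivZ derivXsubC !hornerE.
exact: C2_with_separable.
Qed.

Lemma C2_with_quartic a x : C2_with (quartic a) (fun i y => 4 * (y 0 i - a 0 i) ^+ 3)
  (fun i j y => if i == j then 12 * (y 0 i - a 0 i) ^+ 2 else 0) x.
Proof.
have d1 i : ((('X - (a 0 i)%:P) ^+ 4)^`() = (4 : R) *: ('X - (a 0 i)%:P) ^+ 3)%R.
  by rewrite deriv_exp derivXsubC mul1r scaler_nat.
have -> : (fun (i : 'I_N) y => 4 * (y 0 i - a 0 i) ^+ 3) =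
   (fun i y => ((('X - (a 0 i)%:P) ^+ 4)^`()%R).[y 0 i]).
  by apply/funext => i; apply/funext => y; rewrite d1 !hornerE.
have -> : (fun (i j : 'I_N) (y : V) => if i == j then 12 * (y 0 i - a 0 i) ^+ 2 else 0) =
   (fun i j y => if i == j then ((('X - (a 0 i)%:P) ^+ 4)^`()%R^`()%R).[y 0 i] else 0).
  apply/funext => i; apply/funext => j; apply/funext => y; case: eqP => // _.
  rewrite d1 derivZ deriv_exp derivXsubC mul1r hornerZ hornerMn horner_exp hornerXsubC /=.
  by ring.
exact: C2_with_separable.
Qed.

Lemma C2_near_quartic phi a x (s c : R) : C2_near phi x ->
  C2_near (fun y => phi y + (s * quartic a y + c)) x.
Proof.
move=> /C2_near_with phiC.
by have [] := C2_with_near (C2_withD phiC (C2_withD (C2_withZ s (C2_with_quartic a x)) (C2_with_cst c x))).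
Qed.

Lemma jet_quartic phi a (s c : R) : C2_near phi a ->
  gradient (fun y => phi y + (s * quartic a y + c)) a = gradient phi a /\
  hessian (fun y => phi y + (s * quartic a y + c)) a = hessian phi a.
Proof.
move=> /C2_near_with phiC.
have [_ g h] := C2_with_near (C2_withD phiC (C2_withD (C2_withZ s (C2_with_quartic a a)) (C2_with_cst c a))).
split.
  apply/rowP => i; apply: (etrans (gradientE _ a i)); apply: (etrans (g i)); rewrite (gradientE phi a i).
  by rewrite subrr expr0n /= !mulr0 !addr0.
apply/matrixP => i j; apply: (etrans (hessianE _ a i j)); apply: (etrans (h i j)).
rewrite (hessianE phi a i j).
rewrite subrr expr0n /= mulr0 if_same mulr0 !addr0.
by [].
Qed.

End test_functions.

Section operator.
Context {R : realType} {N : nat}.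
Notation V := 'rV[R]_N.
Context (k : nat) (Omega : set V) (H : V -> V -> R).
Context (kN : (k <= N)%N).
Implicit Types (phi chi : V -> R) (x y a : V).

Definition elliptic_part phi x : R := Pminus k (hessian phi x) + H x (gradient phi x).
Local Notation F := elliptic_part.

Lemma elliptic_part_quartic phi a (s c : R) : C2_near phi a ->
  F (fun y => phi y + (s * quartic a y + c)) a = F phi a.
Proof. by move=> /(jet_quartic s c)[g h]; rewrite /F g h. Qed.

(** Degenerate ellipticity: at the contact point the gradients agree and the
    Hessians are ordered. *)
Lemma elliptic_part_touching phi chi x : C2_near phi x -> C2_near chi x ->
  touches_below chi phi x -> F chi x <= F phi x.
Proof.
move=> phiC chiC [e below].
have phiW := C2_near_with phiC; have chiW := C2_near_with chiC.
have [fC g h] := C2_with_near (C2_withD chiW (C2_withZ (-1) phiW)).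
have [] := local_max_derivatives fC.
  by apply: filterS below => y ?; rewrite e !mulN1r subrr subr_le0.
move=> g0 h0; rewrite /F.
have -> : gradient chi x = gradient phi x.
  apply/rowP => i; rewrite !gradientE; apply/eqP; rewrite -subr_eq0; apply/eqP.
  by rewrite -mulN1r; apply: etrans (g0 i); rewrite (g i).
rewrite lerD2r; apply: Pminus_mono kN (hessian_symmetric chiC) (hessian_symmetric phiC) _.
move=> v; rewrite -subr_le0 qformB; apply: le_trans (h0 v).
rewrite le_eqVlt; apply/orP; left; apply/eqP; congr qform.
apply/matrixP => i j; apply: esym; apply: (etrans (hessianE _ x i j)).
apply: (etrans (h i j)); rewrite mulN1r mxE (hessianE chi x i j).
by congr (_ + _); rewrite mxE (hessianE phi x i j).
Qed.

Context (Oopen : open Omega).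
Context (Hcont : {within Omega `*` [set: V], continuous (fun z : V * V => H z.1 z.2)}).

Lemma gradient_continuous phi x : C2_near phi x -> {for x, continuous (gradient phi)}.
Proof.
move=> phiC; have [h1 _] := nbhs_singleton phiC.
apply/(@cvgrPdist_le _ _ _ _ (nbhs_filter x)) => e e0.
have : \forall y \near x, forall i : 'I_N, `|partial i phi y - partial i phi x| <= e.
  apply: (@filter_forall _ _ (fun i y => `|partial i phi y - partial i phi x| <= e) (nbhs x)) => i.
  by have [_ /continuous_atP] := h1 i; exact.
apply: filterS => y ye; apply/norm_rV_le; first exact: ltW.
by move=> i; rewrite !mxE distrC.
Qed.

Lemma elliptic_part_continuous phi x : C2_near phi x -> Omega x -> {for x, continuous (F phi)}.
Proof.
move=> phiC Ox.
have Hc : {for x, continuous (fun y => H y (gradient phi y))}.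
  have Hx : {for (x, gradient phi x), continuous (fun z : V * V => H z.1 z.2)}.
    have oO : open (Omega `*` [set: V]).
      rewrite openE => -[y xi] [/= Oy _].
      by exists (Omega, setT) => //=; split; [exact: open_nbhs_nbhs|exact: filterT].
    have := Hcont; rewrite continuous_open_subspace // => /(_ (x, gradient phi x)); apply.
    by rewrite inE.
  apply: (@continuous2_cvg _ _ _ _ (nbhs x) (nbhs_filter x) id (gradient phi) H x _ Hx).
    exact: cvg_id.
  exact: gradient_continuous.
have Pc : {for x, continuous (fun y => Pminus k (hessian phi y))}.
  apply/continuous_atP => e e0.
  have [_ h2] := nbhs_singleton phiC.
  have sx := hessian_symmetric phiC.
  pose M : R := N%:R * k%:R + 1.
  have M0 : 0 < M by rewrite ltr_wpDl // mulr_ge0.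
  pose d := e / M; have d0 : 0 < d by rewrite divr_gt0.
  have hc i j : {for x, continuous (fun y => hessian phi y i j)}.
    have -> : (fun y => hessian phi y i j) = partial i (partial j phi).
      by apply/funext => y; exact: hessianE.
    by case: (h2 i j).
  have near_ij : \forall y \near x, forall i j : 'I_N,
      `|hessian phi y i j - hessian phi x i j| <= d.
    apply: (@filter_forall _ _ (fun i y => forall j, `|hessian phi y i j - hessian phi x i j| <= d) (nbhs x)) => i.
    apply: (@filter_forall _ _ (fun j y => `|hessian phi y i j - hessian phi x i j| <= d) (nbhs x)) => j.
    exact: (proj1 (continuous_atP _ _) (hc i j) d d0).
  apply: filterS2 near_ij (C2_near_nearby phiC) => y yd /hessian_symmetric sy.
  have dM : d * N%:R * k%:R <= e.
    rewrite -mulrA /d mulrAC ler_pdivrMr //; apply: ler_wpM2l; first exact: ltW.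
    by rewrite /M lerDl.
  exact: le_trans (Pminus_close kN sy sx yd) dM.
exact: (continuousD Pc Hc).
Qed.

End operator.

(** * Bounds on the first-order term *)

Section enorm.
Context {R : realType} {N : nat}.
Notation V := 'rV[R]_N.
Implicit Types (x y : V).

Lemma enorm_ge0 x : 0 <= enorm x. Proof. exact: sqrtr_ge0. Qed.

Lemma enorm_sqr x : enorm x ^+ 2 = \sum_i x 0 i ^+ 2.
Proof. by rewrite sqr_sqrtr // sumr_ge0 // => i _; exact: sqr_ge0. Qed.

Lemma norm_le_enorm x : `|x| <= enorm x.
Proof.
apply/norm_rV_le; first exact: enorm_ge0.
move=> i; rewrite -(ler_pXn2r (n := 2)) ?nnegrE ?enorm_ge0 //.
rewrite enorm_sqr real_normK ?num_real // (bigD1 i) //= lerDl.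
by apply: sumr_ge0 => j _; exact: sqr_ge0.
Qed.

Lemma enorm_le_norm x : enorm x <= N%:R * `|x|.
Proof.
rewrite -(ler_pXn2r (n := 2)) ?nnegrE ?enorm_ge0 ?mulr_ge0 // enorm_sqr.
apply: (@le_trans _ _ (\sum_(i < N) `|x| ^+ 2)).
  apply: ler_sum => i _; rewrite -[x 0 i ^+ 2]real_normK ?num_real //.
  by rewrite lerXn2r ?nnegrE // coord_le_norm.
rewrite sumr_const card_ord -[_ *+ N]mulr_natl exprMn ler_wpM2r ?exprn_ge0 //.
by case: (N) => [|n]; rewrite ?expr0n //= -natrX ler_nat leq_pmulr.
Qed.

Lemma enormZ (c : R) x : enorm (c *: x) = `|c| * enorm x.
Proof.
apply/eqP; rewrite -(@eqrXn2 _ 2) ?enorm_ge0 ?mulr_ge0 ?enorm_ge0 //; apply/eqP.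
rewrite exprMn real_normK ?num_real // !enorm_sqr mulr_sumr.
by apply: eq_bigr => i _; rewrite mxE exprMn.
Qed.

Lemma sqdist_continuous (a x : V) : {for x, continuous (sqdist a)}.
Proof.
have [C _ _] := C2_with_near (C2_with_sqdist a x).
by have [/C1_continuous] := nbhs_singleton (C2_near_C1 C).
Qed.

Lemma near_enorm (a : V) (P : set V) : (\forall x \near a, P x) ->
  exists2 r : R, 0 < r & forall x, enorm (x - a) <= r -> P x.
Proof.
move=> /near_norm[r r0 rP]; exists (r / 2); first by rewrite divr_gt0.
move=> x xr; apply: rP; apply: le_lt_trans (norm_le_enorm _) _; lra.
Qed.

End enorm.

Section domain.
Context {R : realType} {N : nat}.
Notation V := 'rV[R]_N.
Context (Omega : set V) (H : V -> V -> R).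
Context (hOmega : bounded_domain Omega).
Context (Hcont : {within Omega `*` [set: V], continuous (fun z : V * V => H z.1 z.2)}).
Context (Hhom : positively_homogeneous Omega H).
Context (Hmod : exists2 omega : R -> R,
  modulus_of_continuity omega & structure_condition Omega H omega).
Implicit Types (x y xi : V).

Lemma open_Omega : open Omega. Proof. by case: hOmega. Qed.

Lemma near_Omega x : Omega x -> \forall y \near x, Omega y.
Proof. by move=> Ox; exact: (open_nbhs_nbhs (conj open_Omega Ox)). Qed.

Lemma closure_Omega x : Omega x -> closure Omega x.
Proof. exact: subset_closure. Qed.

Lemma bounded_closure : exists M : R, forall x, closure Omega x -> `|x| <= M.
Proof.
have [_ _ _ [M [_ OM]]] := hOmega.
exists (M + 2) => x Kx.
have : (closure Omega x) by [].
move=> /(_ [set y | `|y - x| < 1]) [].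
  by apply: (proj2 (near_norm x _)); exists 1.
move=> y [Oy /= yx]; have := OM (M + 1) _ y Oy; rewrite ltrDl ltr01 => /(_ isT) yM.
have -> : x = y - (y - x) by rewrite opprB addrCA subrr addr0.
apply: le_trans (ler_normB _ _) _.
by rewrite (_ : M + 2 = (M + 1) + 1); [apply: lerD => //; exact: ltW|ring].
Qed.

Lemma compact_closure : compact (closure Omega).
Proof.
apply: bounded_closed_compact; last exact: closed_closure.
have [M KM] := bounded_closure; exists M; split; first exact: num_real.
by move=> M' MM' x /KM /le_trans; apply; exact: ltW.
Qed.

Lemma H_zero x : Omega x -> H x 0 = 0.
Proof. by move=> Ox; have := Hhom 0 Ox (lexx 0); rewrite scaler0 mul0r; apply. Qed.

Local Notation b := (unit_ball_sup Omega H).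

Lemma H_at_bounded y : Omega y -> exists2 M : R, 0 <= M & forall xi, `|xi| <= 1 -> `|H y xi| <= M.
Proof.
move=> Oy.
have Hx : {for (y, 0 : V), continuous (fun z : V * V => H z.1 z.2)}.
  have oO : open (Omega `*` [set: V]).
    rewrite openE => -[z xi] [/= Oz _].
    by exists (Omega, setT) => //=; split; [exact: near_Omega|exact: filterT].
  have := Hcont; rewrite continuous_open_subspace // => /(_ (y, 0)); apply.
  by rewrite inE.
have : H y xi @[xi --> (0 : V)] --> H y 0.
  apply: (@continuous2_cvg _ _ _ _ (nbhs (0 : V)) (nbhs_filter _) (fun=> y) id H y 0 Hx).
    exact: cvg_cst.
  exact: cvg_id.
move=> /(@cvgrPdist_le _ _ _ _ (nbhs_filter _))/(_ _ ltr01)/near_norm[r r0 rH].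
exists (2 / r); first by rewrite divr_ge0 // ltW.
move=> xi xi1; have r2 : 0 < r / 2 by rewrite divr_gt0.
have := rH ((r / 2) *: xi); rewrite H_zero // subr0 sub0r normrN => h.
have : `|H y ((r / 2) *: xi)| <= 1.
  apply: h; rewrite normrZ gtr0_norm //.
  by apply: le_lt_trans (ler_piMr (ltW r2) xi1) _; lra.
rewrite (Hhom xi Oy (ltW r2)) normrM gtr0_norm // => h1.
have -> : 2 / r = (r / 2)^-1 by field; rewrite ?lt0r_neq0.
by rewrite -[leRHS]mul1r ler_pdivlMr // mulrC.
Qed.

(** At one point [y] the function [H y] is bounded on the unit ball by homogeneity and
    continuity at the origin; the modulus of continuity carries the bound to all of
    the bounded set [Omega]. *)
Lemma unit_ball_has_sup : has_sup [set `|H z.1 z.2| | z in Omega `*` eball 0 1].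
Proof.
have [_ _ [y Oy] _] := hOmega; split.
  exists `|H y 0|, (y, 0) => //=; split=> //.
  by rewrite /eball /= subrr -(scale0r 0) enormZ normr0 mul0r.
have [omega [om_ge0 om_mono _ _] om] := Hmod.
have [M M0 HM] := H_at_bounded Oy.
have [D KD] := bounded_closure.
exists (M + omega (N%:R * (D + D) * 2)) => _ [[x xi] [/= Ox xib] <-] /=.
have xi1 : enorm xi <= 1 by move: xib; rewrite /eball /= subr0 => /ltW.
have -> : H x xi = H y xi + (H x xi - H y xi) by rewrite subrKC.
apply: le_trans (ler_normD _ _) _; apply: lerD.
  by apply: HM; apply: le_trans (norm_le_enorm _) xi1.
apply: le_trans (om x y xi Ox Oy) _; apply: om_mono.
  by rewrite mulr_ge0 ?addr_ge0 ?enorm_ge0.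
apply: ler_pM; rewrite ?addr_ge0 ?enorm_ge0 //; last by lra.
apply: le_trans (enorm_le_norm _) _; rewrite ler_wpM2l //.
apply: le_trans (ler_normB _ _) _; apply: lerD; apply: KD; exact: closure_Omega.
Qed.

Lemma unit_ball_sup_ge0 : 0 <= b.
Proof.
have [[s sS] ub] := unit_ball_has_sup.
by apply: le_trans (ub_le_sup ub sS); case: sS => z _ <-.
Qed.

(** Rescale [xi] into the open unit ball by any [t > enorm xi], then let [t] decrease
    to [enorm xi]. *)
Lemma H_bound x xi : Omega x -> `|H x xi| <= b * enorm xi.
Proof.
move=> Ox; have b0 := unit_ball_sup_ge0.
suff S t : enorm xi < t -> `|H x xi| <= b * t.
  apply/ler_addgt0Pr => e e0.
  have b1 : 0 < b + 1 by lra.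
  have e1 : 0 < e / (b + 1) by rewrite divr_gt0.
  have := S (enorm xi + e / (b + 1)); rewrite ltrDl => /(_ e1) /le_trans; apply.
  rewrite mulrDr lerD2l mulrCA ger_pMr // ler_pdivrMr //; lra.
move=> xit; have t0 : 0 < t by apply: le_lt_trans (enorm_ge0 _) xit.
have -> : xi = t *: (t^-1 *: xi) by rewrite scalerA divff ?scale1r // gt_eqF.
rewrite (Hhom _ Ox (ltW t0)) normrM gtr0_norm // mulrC; apply: ler_wpM2r; first exact: ltW.
apply: ub_le_sup; first by case: unit_ball_has_sup.
exists (x, t^-1 *: xi) => //=; split=> //.
by rewrite /eball /= subr0 enormZ gtr0_norm ?invr_gt0 // mulrC ltr_pdivrMr // mul1r.
Qed.

End domain.

(** * Finiteness of the eigenvalue *)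

Section finiteness.
Context {R : realType} {N : nat}.
Notation V := 'rV[R]_N.
Context (k : nat) (Omega : set V) (H : V -> V -> R).
Context (hk : (1 <= k < N)%N).
Context (hOmega : bounded_domain Omega).
Context (Hcont : {within Omega `*` [set: V], continuous (fun z : V * V => H z.1 z.2)}).
Context (Hhom : positively_homogeneous Omega H).
Context (Hmod : exists2 omega : R -> R,
  modulus_of_continuity omega & structure_condition Omega H omega).
Implicit Types (x y xi a : V).
Local Notation b := (unit_ball_sup Omega H).

Definition admissible mu := exists w : V -> R,
  [/\ usc_on (closure Omega) w, forall x, closure Omega x -> w x < 0 &
      viscosity_subsolution (eigen_operator k H mu) Omega w].

Lemma sum_le_max (n : nat) (F : 'I_n -> R) (i0 : 'I_n) :
  exists m, \sum_i F i <= n%:R * F m.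
Proof.
case: (@Order.TotalTheory.arg_maxP _ _ _ i0 xpredT F isT) => m _ Fm; exists m.
apply: le_trans (_ : \sum_(i < n) F m <= _); first by apply: ler_sum => i _; exact: Fm.
by rewrite sumr_const card_ord mulr_natl.
Qed.

Definition well a (r C : R) : V -> R :=
  fun y => - C * ((sqdist a y + - r ^+ 2) * (sqdist a y + - r ^+ 2)).

Lemma C2_with_well a r C x : C2_with (well a r C)
  (fun i y => - C * (4 * (sqdist a y - r ^+ 2) * (y 0 i - a 0 i)))
  (fun i j y => - C * (4 * (sqdist a y - r ^+ 2) * (i == j)%:R +
     8 * ((y 0 i - a 0 i) * (y 0 j - a 0 j)))) x.
Proof.
have g := C2_withD (C2_with_sqdist a x) (C2_with_cst (- r ^+ 2) x).
have := C2_withZ (- C) (C2_withM g g).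
set f1 := (X in C2_with _ X); set f2 := (X in C2_with _ _ X).
set g1 := (X in _ -> C2_with _ X _ _); set g2 := (X in _ -> C2_with _ _ X _).
have -> : f1 = g1.
  by apply/funext => i; apply/funext => y; rewrite /f1 /g1; ring.
have -> : f2 = g2.
  apply/funext => i; apply/funext => j; apply/funext => y; rewrite /f2 /g2.
  by case: (i == j) => /=; ring.
by [].
Qed.

(** The Hessian of the well is a multiple of the identity plus the rank-one matrix
    [- 8 C (x - a)^T (x - a)]. Choosing [k] diagonal entries that include the largest
    coordinate of [x - a] bounds [Pminus] by a quantity containing
    [- 8 C / N * |x - a| ^ 2], which survives where the well vanishes. *)
Lemma well_estimate a r C x mu : 0 <= r -> 0 <= C -> Omega x ->
  enorm (x - a) <= r ->
  0 <= Pminus k (hessian (well a r C) x) + H x (gradient (well a r C) x) + mu * well a r C x ->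
  0 <= C * (4 * (k%:R + b * r) * (r ^+ 2 - sqdist a x) - 8 / N%:R * sqdist a x
    - mu * (r ^+ 2 - sqdist a x) ^+ 2).
Proof.
move=> r0 C0 Ox xr; have /andP[k1 kN] := hk.
have kN' := ltnW kN.
have [fC g h] := C2_with_near (C2_with_well a r C x).
set s := sqdist a x in g h *.
have sE : s = enorm (x - a) ^+ 2 by exact: sqdistE.
have e0 := enorm_ge0 (x - a).
have sr : s <= r ^+ 2 by rewrite sE lerXn2r ?nnegrE.
have N0 : 0 < N%:R :> R by rewrite ltr0n (leq_trans _ kN).
pose i0 : 'I_N := Ordinal (leq_ltn_trans (leq0n k) kN).
have [m mE] := sum_le_max (fun i => (x 0 i - a 0 i) ^+ 2) i0.
have {mE} sm : s / N%:R <= (x 0 m - a 0 m) ^+ 2.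
  rewrite ler_pdivrMr // mulrC sE enorm_sqr.
  by apply: le_trans mE; rewrite le_eqVlt; apply/orP; left; apply/eqP; apply: eq_bigr => i _; rewrite !mxE.
have hP : Pminus k (hessian (well a r C) x) <= C * (4 * k%:R * (r ^+ 2 - s) - 8 / N%:R * s).
  apply: le_trans (Pminus_le_diag (tperm i0 m) kN' (hessian_symmetric fC)) _.
  rewrite (bigD1 i0) //= tpermL (hessianE _ x m m) (h m m) eqxx mulr1.
  have -> : C * (4 * k%:R * (r ^+ 2 - s) - 8 / N%:R * s) =
     C * (4 * (r ^+ 2 - s)) * k%:R - C * (8 * (s / N%:R)) by field; rewrite gt_eqF.
  rewrite -(sum_ord_lt (R := R) kN') mulr_sumr [X in _ <= X - _](bigD1 i0) //=.
  have rest : \sum_(i < N | (i < k)%N && (i != i0)) hessian (well a r C) x (tperm i0 m i) (tperm i0 m i)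
     <= \sum_(i < N | (i < k)%N && (i != i0)) C * (4 * (r ^+ 2 - s)) * 1.
    apply: ler_sum => i _; set l := tperm i0 m i.
    rewrite (hessianE _ x l l) (h l l) eqxx !mulr1.
    have : 0 <= C * (x 0 l - a 0 l) ^+ 2 by rewrite mulr_ge0 // sqr_ge0.
    move: (x 0 l - a 0 l) => d; nra.
  have top : - C * (4 * (s - r ^+ 2) + 8 * ((x 0 m - a 0 m) * (x 0 m - a 0 m))) <=
     C * (4 * (r ^+ 2 - s)) * 1 - C * (8 * (s / N%:R)).
    have := ler_wpM2l C0 sm; move: (x 0 m - a 0 m) (s / N%:R) => d q; nra.
  by rewrite [leRHS]addrAC; exact: lerD top rest.
have hg : enorm (gradient (well a r C) x) = C * (4 * (r ^+ 2 - s)) * enorm (x - a).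
  have -> : gradient (well a r C) x = (C * (4 * (r ^+ 2 - s))) *: (x - a).
    apply/rowP => i; rewrite (gradientE (well a r C) x i) (g i) !mxE; ring.
  by rewrite enormZ ger0_norm // !mulr_ge0 // subr_ge0.
have hH : H x (gradient (well a r C) x) <= C * (4 * (b * r) * (r ^+ 2 - s)).
  apply: le_trans (ler_norm _) _; apply: le_trans (H_bound hOmega Hcont Hhom Hmod _ Ox) _.
  rewrite hg.
  have -> : C * (4 * (b * r) * (r ^+ 2 - s)) = b * (C * (4 * (r ^+ 2 - s)) * r) by ring.
  apply: ler_wpM2l; first exact: unit_ball_sup_ge0 Hmod.
  by apply: ler_wpM2l => //; rewrite !mulr_ge0 // subr_ge0.
have hw : well a r C x = - C * (r ^+ 2 - s) ^+ 2 by rewrite /well -/s; ring.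
rewrite hw; move: (Pminus _ _) (H x _) hP hH => P Hx hP hH.
move: (8 / N%:R) hP => q hP; nra.
Qed.

(** The well is scaled until it touches [w] from above: the contact point is a
    minimum point of [gp ^ 2 / w] over the closure of [Omega], with [gp] the positive
    part of [r ^ 2 - |y - a| ^ 2]. There the negative constant term of
    [well_estimate] limits [mu]. *)
Lemma admissible_bounded : exists mu0 : R, forall mu, admissible mu -> mu <= mu0.
Proof.
have [_ _ [a Oa] _] := hOmega; have /andP[k1 kN] := hk.
have N0 : 0 < N%:R :> R by rewrite ltr0n (leq_trans _ kN).
have [r r0 rO] := near_enorm (near_Omega hOmega Oa).
have b0 := unit_ball_sup_ge0 hOmega Hcont Hhom Hmod.
pose A := 4 * (k%:R + b * r) + 8 / N%:R.
pose B := 8 / N%:R * r ^+ 2.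
have B0 : 0 < B by rewrite mulr_gt0 ?exprn_gt0 // divr_gt0.
exists (A ^+ 2 / B) => mu [w [wusc wneg [_ wsub]]].
rewrite leNgt; apply/negP => mu_gt.
pose K := closure Omega.
pose gp y := Num.max 0 (r ^+ 2 - sqdist a y).
have gp_c y : {for y, continuous (fun z => gp z ^+ 2)}.
  apply: (@continuous_comp _ _ _ gp (fun t : R => t ^+ 2)); last exact: exprn_continuous.
  apply: continuous_max; first exact: cst_continuous.
  apply: continuousB; first exact: cst_continuous.
  exact: sqdist_continuous.
pose u y := gp y ^+ 2 / w y.
have uK : lsc_on K u.
  apply/lsc_onP => y Ky c cu.
  have wy := wneg y Ky.
  have c0 : c < 0.
    apply: lt_le_trans cu _; rewrite /u mulr_ge0_le0 ?sqr_ge0 //.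
    by rewrite invr_le0 ltW.
  have G : gp y ^+ 2 / - c < - w y.
    rewrite ltr_pdivrMr ?oppr_gt0 // mulrNN mulrC.
    by move: cu; rewrite /u ltr_ndivlMr.
  pose d := (gp y ^+ 2 / - c - w y) / 2.
  have dG : gp y ^+ 2 / - c < d by rewrite /d; lra.
  have dw : d < - w y by rewrite /d; lra.
  have /lsc_onP/(_ y Ky d dw) near_w := wusc.
  have near_g : \forall z \near y, gp z ^+ 2 < d * - c.
    have lt1 : gp y ^+ 2 < d * - c by rewrite -ltr_pdivrMr ?oppr_gt0.
    have /continuous_atP gc := gp_c y.
    have e0 : 0 < (d * - c - gp y ^+ 2) / 2 by rewrite divr_gt0 // subr_gt0.
    apply: filterS (gc _ e0) => z; move: lt1 e0.
    move: (gp z ^+ 2) (gp y ^+ 2) (d * - c) => p q t lt1 e0 /ler_normlP[_ h]; lra.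
  apply: filterS2 near_w near_g => z zw zg Kz; have wz := wneg z Kz.
  rewrite /u ltr_ndivlMr // mulrC.
  apply: lt_trans zg _; have := zw Kz; nra.
have [x1 Kx1 x1min] := lsc_min (compact_closure hOmega) (ex_intro _ a (closure_Omega Oa)) uK.
have sqa : sqdist a a = 0.
  by rewrite sqdistE subrr -(scale0r 0) enormZ normr0 mul0r expr0n.
have ua : u a < 0.
  rewrite /u /gp sqa subr0 max_r ?sqr_ge0 // nmulr_llt0 ?invr_lt0 ?wneg //; last exact: closure_Omega.
  by rewrite !exprn_gt0.
have u1 : u x1 < 0 by apply: le_lt_trans (x1min a (closure_Omega Oa)) ua.
have w1 := wneg x1 Kx1.
have gp1 : 0 < gp x1.
  rewrite lt_neqAle eq_sym le_max lexx /= andbT; apply/eqP => g0.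
  by move: u1; rewrite /u g0 expr0n mul0r ltxx.
have s1 : sqdist a x1 < r ^+ 2.
  by move: gp1; rewrite lt_max ltxx /= subr_gt0.
have gpE y : sqdist a y < r ^+ 2 -> gp y = r ^+ 2 - sqdist a y.
  by move=> h; rewrite /gp max_r // subr_ge0 ltW.
have xr1 : enorm (x1 - a) <= r.
  by rewrite -(ler_pXn2r (n := 2)) ?nnegrE ?enorm_ge0 -?sqdistE // ltW.
have O1 : Omega x1 by exact: rO.
pose C := - w x1 / gp x1 ^+ 2.
have C0 : 0 < C by rewrite divr_gt0 ?oppr_gt0 // exprn_gt0.
have wle y : K y -> w y <= - C * gp y ^+ 2.
  move=> Ky; have := x1min y Ky; rewrite /u.
  have wy := wneg y Ky; have ww : 0 <= w x1 * w y by rewrite ltW // nmulr_rgt0.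
  have g2 : 0 < gp x1 ^+ 2 by rewrite exprn_gt0.
  move=> /(ler_wpM2r ww).
  have -> : gp x1 ^+ 2 / w x1 * (w x1 * w y) = w y * gp x1 ^+ 2 by field; rewrite lt_eqF.
  have -> : gp y ^+ 2 / w y * (w x1 * w y) = gp y ^+ 2 * w x1 by field; rewrite lt_eqF.
  rewrite -ler_pdivlMr // /C => /le_trans; apply.
  by rewrite le_eqVlt; apply/orP; left; apply/eqP; ring.
have near1 : \forall y \near x1, Omega y /\ sqdist a y < r ^+ 2.
  have e0 : 0 < (r ^+ 2 - sqdist a x1) / 2 by rewrite divr_gt0 // subr_gt0.
  have /continuous_atP/(_ _ e0) sc := @sqdist_continuous _ _ a x1.
  apply: filterS2 (near_Omega hOmega O1) sc => y Oy.
  move: (sqdist a y) (sqdist a x1) e0 s1 => p q e0 s1 /ler_normlP[_ h]; split=> //; lra.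
have wE y : sqdist a y < r ^+ 2 -> well a r C y = - C * gp y ^+ 2.
  by move=> /gpE ->; rewrite /well; ring.
have [fC _ _] := C2_with_near (C2_with_well a r C x1).
have w1E : well a r C x1 = w x1.
  by rewrite wE // /C; field; rewrite gt_eqF.
have touch : touches_above (well a r C) w x1.
  split=> //; apply: filterS near1 => y [Oy sy]; rewrite wE //.
  exact/wle/closure_Omega.
have := wsub x1 _ O1 fC touch; rewrite /eigen_operator -w1E.
move=> /(well_estimate (ltW r0) (ltW C0) O1 xr1).
rewrite pmulr_rge0 // => h.
move: s1 h; rewrite -subr_gt0; set t := _ - sqdist a x1 => t0.
have -> : 8 / N%:R * sqdist a x1 = B - 8 / N%:R * t by rewrite /B /t; ring.
rewrite leNgt => /negP; apply.
have -> : 4 * (k%:R + b * r) * t - (B - 8 / N%:R * t) - mu * t ^+ 2 = A * t - B - mu * t ^+ 2.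
  by rewrite /A; ring.
have h1 : A ^+ 2 / B * t ^+ 2 <= mu * t ^+ 2 by rewrite ler_wpM2r ?sqr_ge0 // ltW.
suff : A * t - B - A ^+ 2 / B * t ^+ 2 < 0 by lra.
have -> : A * t - B - A ^+ 2 / B * t ^+ 2 = - (B * ((A * t / B - 1 / 2) ^+ 2 + 3 / 4)).
  by field; rewrite gt_eqF.
rewrite oppr_lt0 mulr_gt0 //; have := sqr_ge0 (A * t / B - 1 / 2); lra.
Qed.

Lemma admissible0 : admissible 0.
Proof.
exists (fun=> -1); have cst K : usc_on K (fun=> -1 : R).
  by apply/lsc_onP => x _ c h; apply: filterS (filterT) => y _ _.
split; [exact: cst|by move=> x _; rewrite ltrN10|split; first exact: cst].
move=> x phi Ox phiC [e above]; rewrite /eigen_operator mul0r addr0.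
have [cC cg ch] := C2_with_near (C2_with_cst (-1 : R) x).
have below : touches_below (fun=> -1) phi x by split.
have /andP[_ kN] := hk.
have := elliptic_part_touching H (ltnW kN) phiC cC below.
rewrite /elliptic_part.
have -> : gradient (fun=> -1) x = 0 by apply/rowP => i; rewrite gradientE cg mxE.
have -> : hessian (fun=> -1) x = 0%:M.
  apply/matrixP => i j; rewrite hessianE ch mxE; by case: eqP.
by rewrite Pminus_scalar ?(ltnW kN) // mulr0 (H_zero Hhom Ox) addr0.
Qed.

Lemma mubar_fin_num : mubar_minus k Omega H \is a fin_num.
Proof.
have [mu0 ub] := admissible_bounded.
rewrite fin_numElt; apply/andP; split.
  apply: lt_le_trans (_ : (0 : R)%:E <= _)%E; first by rewrite ltNyr.
  by apply: ereal_sup_ubound; exists 0 => //; exact: admissible0.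
apply: le_lt_trans (_ : mu0%:E < _)%E; last by rewrite ltry.
by apply: ge_ereal_sup => _ [mu /ub muM <-]; rewrite lee_fin.
Qed.

End finiteness.

(** * The least supersolution *)

Section perron.
Context {R : realType} {N : nat}.
Notation V := 'rV[R]_N.
Context (k : nat) (Omega : set V) (H : V -> V -> R).
Context (hk : (1 <= k < N)%N).
Context (hOmega : bounded_domain Omega).
Context (Hcont : {within Omega `*` [set: V], continuous (fun z : V * V => H z.1 z.2)}).
Context (Hhom : positively_homogeneous Omega H).
Context (Hmod : exists2 omega : R -> R,
  modulus_of_continuity omega & structure_condition Omega H omega).
Implicit Types (x y xi a : V) (u v phi chi : V -> R) (mu c d e : R).
Local Notation b := (unit_ball_sup Omega H).
Local Notation K := (closure Omega).
Local Notation F := (elliptic_part k H).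

Lemma k_le_N : (k <= N)%N. Proof. by case/andP: hk => _ /ltnW. Qed.

Lemma near_closure x : Omega x -> \forall y \near x, K y.
Proof. by move=> /(near_Omega hOmega); apply: filterS => y; exact: closure_Omega. Qed.

Lemma boundaryP x : K x -> ~ Omega x -> boundary Omega x.
Proof.
by move=> Kx nOx; split=> //; rewrite (proj1 (interior_id _) (open_Omega hOmega)).
Qed.

Lemma boundary_notin x : boundary Omega x -> ~ Omega x.
Proof. by case=> _; rewrite (proj1 (interior_id _) (open_Omega hOmega)). Qed.

Lemma elliptic_part_shift phi c x : C2_near phi x ->
  C2_near (fun y => phi y + c) x /\ F (fun y => phi y + c) x = F phi x.
Proof.
move=> /C2_near_with phiC.
have [fC g h] := C2_with_near (C2_withD phiC (C2_with_cst c x)).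
have Eh : hessian (fun y => phi y + c) x = hessian phi x.
  apply/matrixP => i j; apply: (etrans (hessianE _ x i j)); apply: (etrans (h i j)).
  by rewrite (hessianE phi x i j) addr0.
have Eg : gradient (fun y => phi y + c) x = gradient phi x.
  apply/rowP => i; apply: (etrans (gradientE _ x i)); apply: (etrans (g i)).
  by rewrite (gradientE phi x i) addr0.
by split; [exact: fC|rewrite /elliptic_part Eh Eg].
Qed.

Definition supersolution_inequality mu c v := forall x chi, Omega x -> C2_near chi x ->
  touches_below chi v x -> F chi x + mu * v x - c <= 0.

(** The lower bound [-1] normalizes the otherwise homogeneous problem and bounds the
    zero-order term, which makes the barriers uniform over the class. *)
Record supersol_class mu c v : Prop := SupersolClass {
  sc_lsc : lsc_on K v;
  sc_range : forall x, K x -> -1 <= v x <= 0;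
  sc_boundary : forall x, boundary Omega x -> v x = 0;
  sc_visc : supersolution_inequality mu c v }.

Lemma supersol_class_mono mu c mu' c' v : mu <= mu' -> c <= c' ->
  supersol_class mu c v -> supersol_class mu' c' v.
Proof.
move=> mm cc [v1 v2 v3 v4]; split=> // x chi Ox chiC touch.
have := v4 x chi Ox chiC touch; have /andP[_ v0] := v2 x (closure_Omega Ox).
move: (F chi x) (v x) v0 => f w w0; nra.
Qed.

Lemma supersol_class0 mu c : 0 <= c -> supersol_class mu c (fun=> 0).
Proof.
move=> c0; split=> //.
- by apply/lsc_onP => x _ a h; apply: filterS (filterT) => y _ _.
- by move=> x _; rewrite lexx lerN10.
- move=> x chi Ox chiC below; rewrite mulr0 addr0 subr_le0.
  have [cC cg ch] := C2_with_near (C2_with_cst (0 : R) x).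
  apply: le_trans (elliptic_part_touching H k_le_N cC chiC below) _.
  rewrite /elliptic_part.
  have -> : gradient (fun=> 0 : R) x = 0 by apply/rowP => i; rewrite gradientE cg mxE.
  have -> : hessian (fun=> 0 : R) x = 0%:M.
    by apply/matrixP => i j; rewrite hessianE ch mxE; case: eqP.
  by rewrite Pminus_scalar ?k_le_N // mulr0 (H_zero Hhom Ox) addr0.
Qed.

Definition class_graph mu c e y s := exists u, [/\ supersol_class (mu + e) (c + e) u, K y & s = u y].

(** Relaxing the class by [e] in both parameters makes one object serve as the
    least member of the class and as the limit of members for parameters
    decreasing to [(mu, c)]. *)
Definition perron mu c : V -> R := relaxed_liminf (class_graph mu c).

Lemma class_graph_mono mu c d e y s : d <= e -> class_graph mu c d y s -> class_graph mu c e y s.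
Proof.
move=> de [u [uS Ky ->]]; exists u; split=> //.
by apply: supersol_class_mono uS; rewrite lerD2l.
Qed.

Lemma class_graph_lo mu c e y s : class_graph mu c e y s -> -1 <= s.
Proof. by move=> [u [[_ ur _ _] Ky ->]]; have /andP[] := ur y Ky. Qed.

Lemma class_graph_hi mu c e y : 0 <= c -> 0 < e -> K y ->
  exists2 s, class_graph mu c e y s & s <= 0.
Proof.
move=> c0 e0 Ky; exists 0 => //; exists (fun=> 0); split=> //.
by apply: supersol_class0; rewrite addr_ge0 // ltW.
Qed.

Section least.
Context (mu c : R).
Context (mu0 : 0 <= mu) (c0 : 0 <= c).
Let T := class_graph mu c.
Let lo e y s : T e y s -> -1 <= s. Proof. exact: class_graph_lo. Qed.
Let hi e y : 0 < e -> K y -> exists2 s, T e y s & s <= 0.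
Proof. exact: class_graph_hi. Qed.

Lemma perron_lsc : lsc_on K (perron mu c).
Proof. exact: relaxed_liminf_lsc (@class_graph_mono mu c) lo hi. Qed.

Lemma perron_range x : K x -> -1 <= perron mu c x <= 0.
Proof. exact: relaxed_liminf_itv lo hi _. Qed.

Lemma perron_least u x : supersol_class mu c u -> K x -> perron mu c x <= u x.
Proof.
move=> uS Kx; apply: (relaxed_liminf_le lo hi Kx) => e e0; exists u; split=> //.
by apply: supersol_class_mono uS; rewrite lerDl ltW.
Qed.

(** Half of the stability argument: below [perron] the convergence of the infima is
    locally uniform. *)
Lemma perron_locally_uniform (B : set V) phi (eta : R) : compact B -> B `<=` Omega -> 0 < eta ->
  (forall x, B x -> {for x, continuous phi}) ->
  (forall x, B x -> phi x <= perron mu c x) ->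
  exists2 e : R, 0 < e & forall d, 0 < d <= e -> forall x, B x ->
    forall u, supersol_class (mu + d) (c + d) u -> phi x - eta <= u x.
Proof.
move=> cB BO eta0 phic phiV.
apply: (@compact_uniform _ _ B (fun d x => forall u, supersol_class (mu + d) (c + d) u -> phi x - eta <= u x) cB).
move=> x Bx; have Kx := closure_Omega (BO x Bx).
have eta2 : 0 < eta / 2 by rewrite divr_gt0.
have lt1 : phi x - eta / 2 < perron mu c x.
  by apply: lt_le_trans (phiV x Bx); rewrite gtrBl.
have [e e0 eP] := relaxed_liminf_gt lo hi Kx lt1.
exists e => //.
have /continuous_atP/(_ _ eta2) cx := phic x Bx.
have bx : \forall y \near x, `|y - x| < e by apply: (proj2 (near_norm x _)); exists e.
apply: filterS2 (filterI cx bx) (near_closure (BO x Bx)) => y [yphi yx] Ky d /andP[d0 de] u uS.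
have : phi x - eta / 2 <= u y.
  apply: (eP y) => //; exists u; split=> //.
  by apply: supersol_class_mono uS; rewrite lerD2l.
by move: yphi => /ler_normlP[_ h]; move: h; lra.
Qed.

(** Stability. If the inequality failed at [x0], it would fail with a margin for
    [phi' 0 = phi - quartic x0] near [x0]. A member [u] of a slightly relaxed class
    that nearly attains [perron mu c x0] is almost above [phi] on a small ball, so
    that [u - phi' 0] has an interior minimum point [x1], where [phi' m] touches [u]
    from below with [u x1] close to [p]: this contradicts the inequality
    satisfied by [u]. *)
Lemma perron_supersolution : supersolution_inequality mu c (perron mu c).
Proof.
move=> x0 phi Ox0 phiC [pE below].
set p := phi x0 in pE *; rewrite -pE.
rewrite leNgt; apply/negP; set D := _ - c => D0.
pose phi' m := fun y => phi y + (-1 * quartic x0 y + m).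
have phi'C m y : C2_near phi y -> C2_near (phi' m) y by exact: C2_near_quartic.
have phi'F m y : C2_near phi y -> F (phi' m) y = F (phi' 0) y.
  move=> /(phi'C 0)/(elliptic_part_shift m)[_ <-]; congr (F _ y).
  by apply/funext => z; rewrite /phi' addr0 addrA.
(* [t] bounds the variation of the values near [x0], so that [mu * t <= D / 4]. *)
pose t := D / (4 * (mu + 1)).
have mu1 : 0 < mu + 1 by rewrite ltr_wpDl.
have t0 : 0 < t by rewrite divr_gt0 // mulr_gt0.
have mut : mu * t <= D / 4.
  have -> : mu * t = (D / 4) * (mu / (mu + 1)) by rewrite /t; field; rewrite gt_eqF.
  by rewrite ger_pMr ?divr_gt0 // ler_pdivrMr //; lra.
have cphi y : C2_near phi y -> {for y, continuous phi}.
  by move=> /C2_near_C1/nbhs_singleton[/C1_continuous].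
have cphi' m y : C2_near phi y -> {for y, continuous (phi' m)} .
  by move=> /(phi'C m)/C2_near_C1/nbhs_singleton[/C1_continuous].
have phi'p : phi' 0 x0 = p by rewrite /phi' quartic_center mulr0 !addr0.
have phi'F0 : F (phi' 0) x0 = F phi x0 by exact: elliptic_part_quartic.
have near_good : \forall y \near x0, [/\ Omega y, C2_near phi y, phi y <= perron mu c y,
    F phi x0 - D / 4 <= F (phi' 0) y & `|phi' 0 y - p| <= t / 2].
  have D4 : 0 < D / 4 by rewrite divr_gt0.
  have t2 : 0 < t / 2 by rewrite divr_gt0.
  have /continuous_atP/(_ _ D4) cF := elliptic_part_continuous k_le_N (open_Omega hOmega) Hcont (phi'C 0 x0 phiC) Ox0.
  have /continuous_atP/(_ _ t2) cp := cphi' 0 x0 phiC.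
  apply: filterS2 (filterI (near_Omega hOmega Ox0) (filterI (C2_near_nearby phiC) below)) (filterI cF cp).
  move=> y [Oy [Cy by_]] [/ler_normlP[h _] yp]; split=> //; last by rewrite -phi'p.
  by move: h; rewrite phi'F0; move: (F phi x0) (F (phi' 0) y) => f1 f2; lra.
have /near_norm[r1 r10 good] := near_good.
pose r := r1 / 2; have r0 : 0 < r by rewrite divr_gt0.
pose B := [set y : V | `|y - x0| <= r].
have Bgood y : B y -> `|y - x0| < r1 by move=> /= h; apply: le_lt_trans h _; rewrite /r; lra.
have BO : B `<=` Omega by move=> y /Bgood/good[].
have r4 : 0 < r ^+ 4 by rewrite exprn_gt0.
(* On the boundary of [B] the quartic is at least [r ^+ 4], which exceeds the
   errors [3 * eta] made elsewhere. *)
pose eta := Num.min (t / 4) (r ^+ 4 / 4).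
have eta0 : 0 < eta by rewrite lt_min; apply/andP; split; apply: divr_gt0.
have etat : eta <= t / 4 by rewrite /eta ge_min lexx.
have etar : eta <= r ^+ 4 / 4 by rewrite /eta ge_min lexx orbT.
have [e1 e10 low] := @perron_locally_uniform B phi eta (compact_ball r0) BO eta0
  (fun y By => let: And5 _ Cy _ _ _ := good y (Bgood y By) in cphi y Cy)
  (fun y By => let: And5 _ _ py _ _ := good y (Bgood y By) in py).
have /continuous_atP/(_ _ eta0)/near_norm[del del0 close] := cphi' 0 x0 phiC.
pose e := Num.min (Num.min e1 (D / 8)) (Num.min del r).
have D8 : 0 < D / 8 by rewrite divr_gt0.
have e0 : 0 < e by rewrite !lt_min e10 D8 del0 r0.
have [ee1 eD edel er] : [/\ e <= e1, e <= D / 8, e <= del & e <= r].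
  by rewrite /e !ge_min !lexx ?orbT.
have Vlt : perron mu c x0 < p + eta by rewrite -pE ltrDl.
have [y [_ [[u [uS Ky ->]] yx uy]]] := relaxed_liminf_lt lo hi (closure_Omega Ox0) e0 Vlt.
have eI : 0 < e <= e1 by rewrite e0.
have ulow := fun x Bx => low e eI x Bx u uS.
have By : B y by rewrite /B /=; apply: ltW; apply: lt_le_trans yx er.
have phi'0E z : phi' 0 z = phi z - quartic x0 z by rewrite /phi'; ring.
have lscB : lsc_on B (fun z => u z + (- phi' 0 z)).
  apply: lsc_on_add; first by apply: lsc_on_subset (sc_lsc uS) => z /BO; exact: closure_Omega.
  by move=> z /Bgood/good[_ Cz _ _ _]; apply: continuousN; exact: cphi'.
have [x1 Bx1 x1min] := lsc_min (compact_ball r0) (ex_intro _ y By) lscB.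
set m := u x1 + (- phi' 0 x1) in x1min.
have [hO1 hC1 _ F1 p1] := good _ (Bgood _ Bx1).
have m_le : m <= 2 * eta.
  apply: le_trans (x1min y By) _.
  by have /ler_normlP[h _] := close y (lt_le_trans yx edel); move: h uy; rewrite phi'p; lra.
have m_ge : quartic x0 x1 - eta <= m.
  by rewrite /m phi'0E; have := ulow x1 Bx1; lra.
have q0 := quartic_ge0 x0 x1.
have x1r : `|x1 - x0| < r.
  rewrite lt_neqAle (_ : _ <= r) // andbT; apply/eqP => E.
  by have := quartic_ge x0 x1; rewrite E; move: m_le m_ge etar r4; lra.
have u1E : u x1 = phi' 0 x1 + m by rewrite /m; ring.
have touch : touches_below (phi' m) u x1.
  split; first by rewrite u1E /phi'; ring.
  apply: (proj2 (near_norm x1 _)); exists (r - `|x1 - x0|); first by rewrite subr_gt0.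
  move=> z zx; have Bz : B z.
    rewrite /B /=; have -> : z - x0 = (z - x1) + (x1 - x0) by rewrite subrKA.
    by apply: le_trans (ler_normD _ _) _; lra.
  have := x1min z Bz; have -> : phi' m z = phi' 0 z + m by rewrite /phi'; ring.
  by lra.
have := sc_visc uS hO1 (phi'C m x1 hC1) touch; rewrite (phi'F m x1 hC1).
have u_near : p - t <= u x1 by rewrite u1E; move: p1 => /ler_normlP[h1 h2]; lra.
have /andP[u_lo _] := sc_range uS (closure_Omega hO1).
have mu_u : mu * (p - t) <= mu * u x1 by rewrite ler_wpM2l.
have e_u : e * -1 <= e * u x1 by rewrite ler_wpM2l // ltW.
rewrite mulrDl; move: F1 mu_u e_u mut eD D0; rewrite /D mulrBr.
move: (F phi x0) (F (phi' 0) x1) (mu * p) (mu * u x1) (e * u x1) (mu * t) => f0 f1 a1 a2 a3 a4.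
lra.
Qed.

End least.

(** * The barrier *)

Section barrier.
Context (rho : R) (Y : set V).
Context (rho0 : 0 < rho).
Context (OmegaE : Omega = \bigcap_(y in Y) eball y rho).
Context (b_rho : b * rho < k%:R).
Let delta := k%:R - b * rho.

Lemma sqdist_le_radius y x : Y y -> K x -> sqdist y x <= rho ^+ 2.
Proof.
move=> Yy Kx; rewrite leNgt; apply/negP => lt.
have e0 : 0 < (sqdist y x - rho ^+ 2) / 2 by rewrite divr_gt0 // subr_gt0.
have /continuous_atP/(_ _ e0) c := @sqdist_continuous _ _ y x.
have [z [Oz zx]] := Kx _ c.
have : sqdist y z < rho ^+ 2.
  move: Oz; rewrite OmegaE => /(_ y Yy); rewrite /eball /= sqdistE => zr.
  by rewrite ltrXn2r ?nnegrE ?enorm_ge0 // ltW.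
by move: zx => /ler_normlP[h _]; move: h e0; lra.
Qed.

(** Otherwise all the centres in [Y] would be at distance less than [rho] from [x],
    and [x] would belong to the intersection [Omega] of the balls. *)
Lemma sqdist_near_radius x e : K x -> ~ Omega x -> 0 < e ->
  exists2 y, Y y & rho ^+ 2 - e < sqdist y x.
Proof.
move=> Kx nOx e0; apply: contrapT => nY.
have far y : Y y -> sqdist y x <= rho ^+ 2 - e.
  by move=> Yy; rewrite leNgt; apply/negP => h; apply: nY; exists y.
apply: nOx; rewrite OmegaE => y Yy /=; rewrite /eball /=.
have := far y Yy; rewrite sqdistE => h.
rewrite -(ltr_pXn2r (n := 2)) ?nnegrE ?enorm_ge0 ?ltW //.
by apply: le_lt_trans h _; rewrite gtrBl.
Qed.

(** The gain of a paraboloid: its Hessian contributes [2 C k], while its gradient has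
    norm at most [2 C rho] on [Omega]. *)
Lemma elliptic_part_sqdist C m y x : 0 <= C -> Y y -> Omega x ->
  C2_near (fun z => C * (sqdist y z - rho ^+ 2) + m) x /\
  2 * C * delta <= F (fun z => C * (sqdist y z - rho ^+ 2) + m) x.
Proof.
move=> C0 Yy Ox.
have W := C2_withD (C2_withZ C (C2_withD (C2_with_sqdist y x) (C2_with_cst (- rho ^+ 2) x))) (C2_with_cst m x).
have [fC g h] := C2_with_near W; split; first exact: fC.
set psi := fun z => _ in fC g h *.
have Eh : hessian psi x = (2 * C)%:M.
  apply/matrixP => i j; apply: (etrans (hessianE _ x i j)); apply: (etrans (h i j)).
  by rewrite !addr0 mxE; case: (i == j); rewrite ?mulr1n ?mulr0n ?mulr0 // mulrC.
have Eg : gradient psi x = (2 * C) *: (x - y).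
  apply/rowP => i; apply: (etrans (gradientE _ x i)); apply: (etrans (g i)).
  by rewrite !mxE; ring.
rewrite /elliptic_part Eh Eg (Pminus_scalar _ k_le_N).
have C2 : 0 <= 2 * C by rewrite mulr_ge0.
have xy : enorm (x - y) <= rho.
  by move: Ox; rewrite OmegaE => /(_ y Yy); rewrite /eball /= => /ltW.
have := H_bound hOmega Hcont Hhom Hmod ((2 * C) *: (x - y)) Ox.
rewrite enormZ (ger0_norm C2) => /ler_normlP[h1 _].
have b0 := unit_ball_sup_ge0 hOmega Hcont Hhom Hmod.
have : b * (2 * C * enorm (x - y)) <= b * (2 * C * rho) by rewrite ler_wpM2l // ler_wpM2l.
move: h1; rewrite /delta; move: (H x _) (b * (2 * C * enorm (x - y))) => h0 a0.
lra.
Qed.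

(** At an interior minimum point of [v] minus the paraboloid the inequality for [v]
    would contradict [elliptic_part_sqdist]; on the boundary the paraboloid is
    nonpositive and [v] vanishes. *)
Lemma barrier mu c v C y x : 0 <= mu -> supersol_class mu c v -> 0 <= C ->
  c + mu < 2 * C * delta -> Y y -> K x -> C * (sqdist y x - rho ^+ 2) <= v x.
Proof.
move=> mu0 [vlsc vr vb vv] C0 Cbig Yy Kx.
have gc z : {for z, continuous (fun z => - (C * (sqdist y z - rho ^+ 2)))}.
  apply: continuousN; apply: continuousM; first exact: cst_continuous.
  by apply: continuousB; [exact: sqdist_continuous|exact: cst_continuous].
have lscg := lsc_on_add vlsc (fun z _ => gc z).
have [x1 Kx1 x1min] := lsc_min (compact_closure hOmega) (ex_intro _ x Kx) lscg.
set m := v x1 + _ in x1min.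
suff m0 : 0 <= m by have := le_trans m0 (x1min x Kx); rewrite subr_ge0.
have [hO1|nO1] := pselect (Omega x1); last first.
  rewrite /m (vb x1 (boundaryP Kx1 nO1)) add0r oppr_ge0 mulr_ge0_le0 // subr_le0.
  exact: sqdist_le_radius.
rewrite leNgt; apply/negP => m_lt0.
have [fC Fge] := @elliptic_part_sqdist C m y x1 C0 Yy hO1.
have touch : touches_below (fun z => C * (sqdist y z - rho ^+ 2) + m) v x1.
  split; first by rewrite /m; ring.
  by apply: filterS (near_closure hO1) => z Kz; have := x1min z Kz; lra.
have := vv x1 _ hO1 fC touch.
have /andP[v1 _] := vr x1 Kx1.
have : mu * -1 <= mu * v x1 by rewrite ler_wpM2l.
move: Fge Cbig; move: (F _ x1) (mu * v x1) => f a; lra.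
Qed.

Section class.
Context (mu c : R).
Context (mu0 : 0 <= mu) (c0 : 0 <= c).
Let T := class_graph mu c.
Let lo e y s : T e y s -> -1 <= s. Proof. exact: class_graph_lo. Qed.
Let hi e y : 0 < e -> K y -> exists2 s, T e y s & s <= 0.
Proof. exact: class_graph_hi. Qed.

(** Near [x] all members of the relaxed classes lie above the same multiple of a
    paraboloid that almost vanishes at [x]. *)
Lemma perron_boundary x : boundary Omega x -> perron mu c x = 0.
Proof.
move=> bx; have Kx : K x by case: bx.
have /andP[_ V0] := perron_range mu c0 Kx.
apply/eqP; rewrite eq_le V0 /=.
have d0 : 0 < delta by rewrite subr_gt0.
(* Large enough for [barrier] at all levels [e <= 1]. *)
pose C := (c + mu + 3) / delta.
have C0 : 0 < C by apply: divr_gt0 d0; move: mu0 c0; lra.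
have CE : C * delta = c + mu + 3 by rewrite /C divfK // gt_eqF.
apply/ler_addgt0Pr => e e0.
have e1 : 0 < e / (2 * C) by rewrite divr_gt0 // mulr_gt0.
have [y Yy yx] := sqdist_near_radius Kx (boundary_notin bx) e1.
suff : - e <= perron mu c x by lra.
have ec : C * (e / (2 * C)) = e / 2 by field; rewrite gt_eqF.
have gx : C * (sqdist y x - rho ^+ 2) > - (e / 2).
  have : C * (rho ^+ 2 - e / (2 * C)) < C * sqdist y x by rewrite ltr_pM2l.
  by rewrite !mulrBr ec; lra.
have e4 : 0 < e / (2 * C) by [].
have /continuous_atP/(_ _ e4)/near_norm[d d0' close] := @sqdist_continuous _ _ y x.
have dd : 0 < Num.min 1 d by rewrite lt_min ltr01.
apply: (le_relaxed_liminf lo hi Kx dd) => z s [u [uS Kz ->]].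
rewrite lt_min => /andP[_ /close/ler_normlP[h _]].
have min1 : Num.min 1 d <= 1 by rewrite ge_min lexx.
have bz : C * (sqdist y z - rho ^+ 2) <= u z.
  apply: barrier uS (ltW C0) _ Yy Kz; first exact: addr_ge0 mu0 (ltW dd).
  by rewrite -mulrA CE; move: min1 mu0 c0; lra.
apply: le_trans bz.
have : C * (sqdist y x - sqdist y z) <= C * (e / (2 * C)).
  by apply: ler_wpM2l; [exact: ltW|move: h; lra].
rewrite ec; move: gx; rewrite !mulrBr; lra.
Qed.

Lemma perron_in_class : supersol_class mu c (perron mu c).
Proof.
split.
- exact: perron_lsc.
- by move=> x; exact: perron_range.
- exact: perron_boundary.
- exact: perron_supersolution.
Qed.

(** * Lowering the least supersolution *)

(** The upper envelope of [perron] is the opposite of the lower relaxed limit of the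
    single function [- perron], at every level [e]. *)
Definition opp_graph (e : R) (y : V) (s : R) := K y /\ s = - perron mu c y.
Definition usc_envelope x := - relaxed_liminf opp_graph x.
Let og_mono d e y s : d <= e -> opp_graph d y s -> opp_graph e y s. Proof. by []. Qed.
Let og_lo e y s : opp_graph e y s -> 0 <= s.
Proof. by move=> [Ky ->]; rewrite oppr_ge0; have /andP[] := perron_range mu c0 Ky. Qed.
Let og_hi e y : 0 < e -> K y -> exists2 s, opp_graph e y s & s <= 1.
Proof.
move=> _ Ky; exists (- perron mu c y) => //.
by rewrite lerNl; have /andP[] := perron_range mu c0 Ky.
Qed.

Lemma usc_envelope_usc : usc_on K usc_envelope.
Proof.
rewrite /usc_on (_ : (fun x => - usc_envelope x) = relaxed_liminf opp_graph).
  exact: relaxed_liminf_lsc og_mono og_lo og_hi.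
by apply/funext => x; rewrite /usc_envelope opprK.
Qed.

Lemma usc_envelope_le0 x : K x -> usc_envelope x <= 0.
Proof. by move=> Kx; rewrite oppr_le0; have /andP[] := relaxed_liminf_itv og_lo og_hi Kx. Qed.

Lemma perron_le_usc_envelope x : K x -> perron mu c x <= usc_envelope x.
Proof. by move=> Kx; rewrite lerNr; apply: (relaxed_liminf_le og_lo og_hi Kx) => e e0. Qed.

(** The bump construction. If the inequality failed at [x0], then
    [psi = phi + quartic x0 - kap] would be a supersolution near [x0]. It
    lies above [perron] away from [x0], because of the quartic, so the minimum [U] of
    both belongs to the class. By minimality [perron <= psi] near [x0], hence
    [usc_envelope x0 <= phi x0 - kap / 2], which contradicts the contact. The lower
    bound [- 1 / 2] leaves room for [kap] above [-1]. *)
Lemma usc_envelope_subsolution : (forall x, K x -> - (1 / 2) <= perron mu c x) ->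
  forall x phi, Omega x -> C2_near phi x -> touches_above phi usc_envelope x ->
    0 <= F phi x + mu * usc_envelope x - c.
Proof.
move=> Vhalf x0 phi Ox0 phiC [pE above].
set p := phi x0 in pE *; rewrite -pE.
rewrite leNgt; apply/negP; set D := _ - c => D0.
pose phi' kap := fun y => phi y + (1 * quartic x0 y + kap).
have phi'C m y : C2_near phi y -> C2_near (phi' m) y by exact: C2_near_quartic.
have phi'F m y : C2_near phi y -> F (phi' m) y = F (phi' 0) y.
  move=> /(phi'C 0)/(elliptic_part_shift m)[_ <-]; congr (F _ y).
  by apply/funext => z; rewrite /phi' addr0 addrA.
have cphi' m y : C2_near phi y -> {for y, continuous (phi' m)} .
  by move=> /(phi'C m)/C2_near_C1/nbhs_singleton[/C1_continuous].
have mu1 : 0 < mu + 1 by rewrite ltr_wpDl.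
have ND : 0 < - D by rewrite oppr_gt0.
pose t := - D / (2 * (mu + 1)).
have t0 : 0 < t by rewrite divr_gt0 // mulr_gt0.
have mut : mu * t <= - D / 2.
  have -> : mu * t = (- D / 2) * (mu / (mu + 1)) by rewrite /t; field; rewrite gt_eqF.
  by rewrite ger_pMr ?divr_gt0 // ler_pdivrMr //; lra.
have phi'p m : phi' m x0 = p + m by rewrite /phi' quartic_center mulr0 add0r.
have phi'F0 : F (phi' 0) x0 = F phi x0 by exact: elliptic_part_quartic.
have near_good : \forall y \near x0, [/\ Omega y, C2_near phi y, usc_envelope y <= phi y,
    F (phi' 0) y <= F phi x0 - D / 2 & phi' 0 y <= p + t].
  have D2 : 0 < - D / 2 by rewrite divr_gt0.
  have /continuous_atP/(_ _ D2) cF := elliptic_part_continuous k_le_N (open_Omega hOmega) Hcont (phi'C 0 x0 phiC) Ox0.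
  have /continuous_atP/(_ _ t0) cp := cphi' 0 x0 phiC.
  apply: filterS2 (filterI (near_Omega hOmega Ox0) (filterI (C2_near_nearby phiC) above)) (filterI cF cp).
  move=> y [Oy [Cy ab]] [/ler_normlP[_ h] /ler_normlP[_ yp]]; split=> //.
    by move: h; rewrite phi'F0; move: (F phi x0) (F (phi' 0) y) => f1 f2; lra.
  by move: yp; rewrite phi'p; lra.
have /near_norm[r1 r10 good] := near_good.
pose r := r1 / 2; have r0 : 0 < r by rewrite divr_gt0.
have rr1 : r < r1 by rewrite /r; lra.
have r4 : 0 < r ^+ 4 by rewrite exprn_gt0.
(* [kap < r ^+ 4] keeps [psi] above [phi] outside the ball of radius [r], and
   [kap <= 1 / 2] keeps it above [-1]. *)
pose kap := Num.min (r ^+ 4 / 2) (1 / 2).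
have kap0 : 0 < kap by rewrite lt_min; apply/andP; split; apply: divr_gt0.
have kapr : kap <= r ^+ 4 / 2 by rewrite /kap ge_min lexx.
have kap1 : kap <= 1 / 2 by rewrite /kap ge_min lexx orbT.
pose psi := phi' (- kap).
have psiE y : psi y = phi' 0 y - kap by rewrite /psi /phi'; ring.
have psi_phi y : psi y = phi y + quartic x0 y - kap by rewrite /psi /phi'; ring.
pose U y := if `|y - x0| < r1 then Num.min (perron mu c y) (psi y) else perron mu c y.
have U_le y : U y <= perron mu c y by rewrite /U; case: ifP => // _; rewrite ge_min lexx.
have U_out y : r <= `|y - x0| -> U y = perron mu c y.
  move=> ry; rewrite /U; case: ifP => // yr1; apply: min_l.
  have [Oy _ Wy _ _] := good y yr1; have Ky := closure_Omega Oy.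
  rewrite psi_phi; have := quartic_ge x0 y.
  have : r ^+ 4 <= `|y - x0| ^+ 4 by rewrite lerXn2r ?nnegrE // ltW.
  by have := perron_le_usc_envelope Ky; move: Wy kapr r4; lra.
have psi_ge y : `|y - x0| < r1 -> -1 <= psi y.
  move=> yr1; have [Oy _ Wy _ _] := good y yr1; have Ky := closure_Omega Oy.
  rewrite psi_phi; have := quartic_ge0 x0 y; have := perron_le_usc_envelope Ky.
  by have := Vhalf y Ky; move: Wy kap1; lra.
have Uclass : supersol_class mu c U.
  split.
  - apply/lsc_onP => x Kx a aU.
    have [xr1|xr1] := ltP (`|x - x0|) r1.
      have [Ox Cx _ _ _] := good x xr1.
      move: aU; rewrite /U xr1 lt_min => /andP[aV apsi].
      have nV := proj1 (lsc_onP K _) (@perron_lsc mu c c0) x Kx a aV.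
      have e0 : 0 < (psi x - a) / 2 by rewrite divr_gt0 // subr_gt0.
      have /continuous_atP/(_ _ e0) npsi := cphi' (- kap) x Cx.
      apply: filterS2 nV npsi => y ya /ler_normlP[h _] Ky.
      have ya' : a < psi y by move: h e0; rewrite -/psi; lra.
      by case: ifP => _; rewrite ?lt_min ?ya' ya.
    have xr : r < `|x - x0| by apply: lt_le_trans xr1.
    have aV : a < perron mu c x by apply: lt_le_trans aU (U_le x).
    have nV := proj1 (lsc_onP K _) (@perron_lsc mu c c0) x Kx a aV.
    have out : \forall y \near x, r <= `|y - x0|.
      apply: (proj2 (near_norm x _)); exists (`|x - x0| - r); first by rewrite subr_gt0.
      move=> y yx; have -> : y - x0 = (x - x0) - (x - y) by apply/rowP => i; rewrite !mxE; ring.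
      have := lerB_dist (x - x0) (x - y); rewrite (distrC x y); lra.
    by apply: filterS2 nV out => y ya yo Ky; rewrite U_out //; exact: ya.
  - move=> x Kx; have /andP[V1 V0] := perron_range mu c0 Kx.
    rewrite (le_trans (U_le x) V0) andbT /U; case: ifP => // xr1.
    by rewrite le_min V1 psi_ge.
  - move=> x bx; rewrite -(perron_boundary bx) /U; case: ifP => // xr1.
    by have [Ox _ _ _ _] := good x xr1; case: (boundary_notin bx Ox).
  - move=> x chi Ox chiC [cE cbelow].
    have [UV|UV] := eqVneq (U x) (perron mu c x).
      rewrite UV; apply: (perron_supersolution mu0 c0 Ox chiC); split; first by rewrite cE UV.
      by apply: filterS cbelow => y /le_trans; apply; exact: U_le.
    have xr1 : `|x - x0| < r1.
      by rewrite ltNge; apply/negP => h; case/eqP: UV; rewrite U_out // (le_trans (ltW rr1)).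
    have Upsi y : `|y - x0| < r1 -> U y <= psi y.
      by move=> yr1; rewrite /U yr1 ge_min lexx orbT.
    have Ux : U x = psi x.
      move: UV; rewrite /U xr1; have [h|h] := leP (perron mu c x) (psi x); first by rewrite eqxx.
      by [].
    have [_ Cx _ Fx px] := good x xr1.
    have below : touches_below chi psi x.
      split; first by rewrite cE Ux.
      have inb : \forall y \near x, `|y - x0| < r1.
        apply: (proj2 (near_norm x _)); exists (r1 - `|x - x0|); first by rewrite subr_gt0.
        move=> y yx; have -> : y - x0 = (y - x) + (x - x0) by rewrite subrKA.
        by apply: le_lt_trans (ler_normD _ _) _; lra.
      by apply: filterS2 cbelow inb => y h /Upsi; exact: le_trans.
    have := elliptic_part_touching H k_le_N (phi'C (- kap) x Cx) chiC below; rewrite phi'F // Ux psiE.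
    have : mu * (phi' 0 x - kap) <= mu * (p + t).
      by apply: ler_wpM2l => //; move: px kap0; lra.
    move: Fx mut; rewrite (mulrDr mu p t) /D.
    move: (F chi x) (F (phi' 0) x) (F phi x0) (mu * (phi' 0 x - kap)) (mu * t) (mu * p) => f1 f2 f3 a1 a2 a3.
    lra.
have kap2 : 0 < kap / 2 by rewrite divr_gt0.
have /continuous_atP/(_ _ kap2)/near_norm[del del0 close] := cphi' (- kap) x0 phiC.
suff : kap / 2 - p <= - p by lra.
rewrite {2}pE /usc_envelope opprK.
have dd : 0 < Num.min del r1 by rewrite lt_min del0.
apply: (le_relaxed_liminf og_lo og_hi (closure_Omega Ox0) dd) => y s [Ky ->].
rewrite lt_min => /andP[yd yr1].
have := perron_least c0 Uclass Ky.
have : U y <= psi y by rewrite /U yr1 ge_min lexx orbT.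
by have /ler_normlP[_] := close y yd; rewrite phi'p -/psi; lra.
Qed.

End class.

(** If [perron] stayed above [- 1 / 2], then its upper envelope, shifted down by [e] to
    make it negative, would be admissible for [mu]: the shift costs [mu * e <= c]. *)
Lemma perron_nontrivial mu c : 0 <= mu -> 0 < c -> ~ admissible k Omega H mu ->
  exists2 x, K x & perron mu c x <= - (1 / 2).
Proof.
move=> mu0 c0 nadm; apply: contrapT => nhalf; apply: nadm.
have Vhalf x : K x -> - (1 / 2) <= perron mu c x.
  move=> Kx; rewrite leNgt; apply/negP => h; apply: nhalf; exists x => //; exact: ltW.
have c0' := ltW c0.
have mu1 : 0 < mu + 1 by rewrite ltr_wpDl.
pose e := c / (mu + 1); have e0 : 0 < e by rewrite divr_gt0.
have mue : mu * e <= c.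
  by rewrite /e mulrCA ger_pMr // ler_pdivrMr // mul1r lerDl.
have uscW : usc_on K (fun x => usc_envelope mu c x - e).
  have -> : (fun x => usc_envelope mu c x - e) = (fun x => - (- usc_envelope mu c x + e)).
    by apply/funext => x; ring.
  rewrite /usc_on; have -> : (fun x => - - (- usc_envelope mu c x + e)) = (fun x => - usc_envelope mu c x + e).
    by apply/funext => x; rewrite opprK.
  exact: (@lsc_on_add _ _ K (fun x => - usc_envelope mu c x) (fun=> e) (usc_envelope_usc c0')
    (fun x _ => @cst_continuous _ _ e x)).
exists (fun x => usc_envelope mu c x - e); split => //.
  by move=> x Kx; have := usc_envelope_le0 mu c0' Kx; lra.
split; first by apply: lsc_on_subset uscW => x; exact: closure_Omega.
move=> x phi Ox phiC [pE above]; rewrite /eigen_operator.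
have [sC sF] := elliptic_part_shift e phiC.
have touch : touches_above (fun y => phi y + e) (usc_envelope mu c) x.
  split; first by rewrite pE subrK.
  by apply: filterS above => y; rewrite lerBlDr.
have := usc_envelope_subsolution mu0 c0' Vhalf Ox sC touch; rewrite sF /elliptic_part.
rewrite mulrBr; move: (Pminus _ _) (H x _) (mu * usc_envelope mu c x) => a1 a2 a3.
by move: mue; lra.
Qed.

(** If [perron mu 0] vanished, then all the members of [supersol_class (mu + e) e]
    would be above [- 1 / 4] for some [e > 0], by compactness; but [perron (mu + e) e]
    is not. *)
Lemma perron_limit_nontrivial mu : 0 <= mu ->
  (forall mu', mu < mu' -> ~ admissible k Omega H mu') ->
  exists2 x, K x & perron mu 0 x != 0.
Proof.
move=> mu0 nadm; apply: contrapT => zero.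
have V0 x : K x -> perron mu 0 x = 0.
  by move=> Kx; apply/eqP; apply/negPn/negP => h; apply: zero; exists x.
have half0 : - (1 / 4) < 0 :> R by lra.
have [|e e0 eP] := @compact_uniform _ _ K
    (fun d x => K x -> forall u, supersol_class (mu + d) (0 + d) u -> - (1 / 4) <= u x)
    (compact_closure hOmega).
  move=> x Kx.
  have lt1 : - (1 / 4) < perron mu 0 x by rewrite V0.
  have hi e y : 0 < e -> K y -> exists2 s, class_graph mu 0 e y s & s <= 0.
    exact: class_graph_hi.
  have [e e0 eP] := relaxed_liminf_gt (@class_graph_lo mu 0) hi Kx lt1.
  exists e => //; apply: (proj2 (near_norm x _)); exists e => // y yx d /andP[d0 de] Ky u uS.
  apply: (eP y) => //; exists u; split=> //.
  by apply: supersol_class_mono uS; rewrite lerD2l.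
have mue : 0 <= mu + e by rewrite addr_ge0 // ltW.
have lt_mu : mu < mu + e by rewrite ltrDl.
have [x Kx xhalf] := perron_nontrivial mue e0 (nadm _ lt_mu).
have eI : 0 < e <= e by rewrite e0 lexx.
have uS : supersol_class (mu + e) (0 + e) (perron (mu + e) e).
  by rewrite add0r; apply: perron_in_class; rewrite // ltW.
have := eP e eI x Kx Kx _ uS; move: xhalf; lra.
Qed.

End barrier.
End perron.

(** * The theorem *)

Theorem proposition4p5 (R : realType) (N k : nat) (Omega : set 'rV[R]_N)
    (H : 'rV[R]_N -> 'rV[R]_N -> R)
    (hN : (2 <= N)%N) (hk : (1 <= k < N)%N)
    (hOmega : bounded_domain Omega)
    (hHcont : {within Omega `*` [set: 'rV[R]_N],
                 continuous (fun z : 'rV[R]_N * 'rV[R]_N => H z.1 z.2)})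
    (hHhom : positively_homogeneous Omega H)
    (hHmod : exists2 omega : R -> R,
               modulus_of_continuity omega & structure_condition Omega H omega) :
  mubar_minus k Omega H \is a fin_num /\
  ((exists rho : R, [/\ 0 < rho, ball_intersection_class rho Omega &
                        unit_ball_sup Omega H * rho < k%:R]) ->
   exists v : 'rV[R]_N -> R,
     [/\ lsc_on (closure Omega) v,
         forall x, closure Omega x -> v x <= 0,
         exists2 x, closure Omega x & v x != 0,
         forall x, boundary Omega x -> v x = 0 &
         viscosity_supersolution
           (eigen_operator k H (fine (mubar_minus k Omega H))) Omega v]).
Proof.
have fin := mubar_fin_num hk hOmega hHcont hHhom hHmod; split=> //.
move=> [rho [rho0 [_ [Y OmegaE]] b_rho]].
set mu := fine _.
have muE : mu%:E = mubar_minus k Omega H by rewrite fineK.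
have mu0 : 0 <= mu.
  rewrite -lee_fin muE; apply: ereal_sup_ubound; exists 0 => //.
  exact: admissible0 hk hHhom.
have nadm mu' : mu < mu' -> ~ admissible k Omega H mu'.
  move=> mm adm; move: mm; apply/negP; rewrite -leNgt -lee_fin muE.
  by apply: ereal_sup_ubound; exists mu'.
have [vlsc vr vb vv] := perron_in_class hk hOmega hHcont hHhom hHmod rho0 OmegaE b_rho mu0 (lexx 0).
exists (perron k Omega H mu 0); split => //.
- by move=> x /vr/andP[].
- exact: (perron_limit_nontrivial hk hOmega hHcont hHhom hHmod rho0 OmegaE b_rho mu0 nadm).
- split; first by apply: lsc_on_subset vlsc => x; exact: closure_Omega.
  move=> x phi Ox phiC touch; have := vv x phi Ox phiC touch.
  by rewrite subr0 /elliptic_part /eigen_operator.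
Qed.
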